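(* Let $(W,S)$ be a finite Coxeter group and let $\delta: W\to W$ be a group automorphism sending simple reflections to simple reflections. Set $\tilde W=\langle\delta\rangle\ltimes W$. Let $\mathcal O$ be a $W$-conjugacy class in $\tilde W$ (an orbit of $W$ acting on $\tilde W$ by conjugation) and let $\mathcal O_{\min}$ be the set of elements of minimal length in $\mathcal O$. Then: (1) For each $w\in\mathcal O$ there exists $w'\in\mathcal O_{\min}$ such that $w\to w'$. (2) If $w,w'\in\mathcal O_{\min}$, then $w\sim w'$.
   Context: The simple reflections of $W$ are denoted $s_i$ ($i\in S$) and $\ell$ is the length function of $W$; $\langle\delta\rangle$ is the cyclic group generated by $\delta$. The length is extended to $\tilde W$ by $\ell(\delta^k w)=\ell(w)$ for $k\in\mathbb Z$, $w\in W$. For $\tilde w,\tilde w'\in\tilde W$ and $i\in S$ write $\tilde w\xrightarrow{s_i}\tilde w'$ if $\tilde w'=s_i\tilde w s_i$ and $\ell(\tilde w')\le\ell(\tilde w)$. Write $\tilde w\to\tilde w'$ if there is a finite sequence $\tilde w=\tilde w_0,\tilde w_1,\dots,\tilde w_n=\tilde w'$ in $\tilde W$ such that for each $k$ one has $\tilde w_{k-1}\xrightarrow{s_i}\tilde w_k$ for some $i\in S$. Elements $\tilde w,\tilde w'\in\tilde W$ are elementarily strongly conjugate if $\ell(\tilde w)=\ell(\tilde w')$ and there exists $x\in W$ such that $\tilde w'=x\tilde w x^{-1}$ and either $\ell(x\tilde w)=\ell(x)+\ell(\tilde w)$ or $\ell(\tilde w x^{-1})=\ell(x)+\ell(\tilde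 w)$. They are strongly conjugate, written $\tilde w\sim\tilde w'$, if there is a finite sequence $\tilde w=\tilde w_0,\dots,\tilde w_n=\tilde w'$ with consecutive terms elementarily strongly conjugate. *)

(* Defs.v *)
From HB Require Import structures.
From mathcomp Require Import all_boot all_fingroup.

Set Implicit Arguments.
Unset Strict Implicit.
Unset Printing Implicit Defensive.

Local Open Scope group_scope.

(* (W, S) is a Coxeter system (Bourbaki): S generates W, consists of elements *)
(* of order 2, and W is presented by S with the relations (st)^m(s,t) = 1,    *)
(* where m(s,t) is the order of st. The presentation is expressed by its      *)
(* universal property among all, possibly infinite, groups H. Taking s = t    *)
(* gives the relations s^2 = 1. Since W is finite no m(s,t) is infinite.      *)
Definition coxeter_system (W : finGroupType) (S : {set W}) : Prop :=
  [/\ <<S>> = [set: W],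
      {in S, forall s, #[s] = 2} &
      forall (H : groupType) (f : W -> H),
        {in S &, forall s t, (f s * f t) ^+ #[s * t] = 1} ->
        exists2 phi : W -> H, {morph phi : x y / x * y} & {in S, phi =1 f}].

(* S ^+ n is the set of products of n elements of S, so this is the least n   *)
(* such that w is such a product; the search bound #|W| is harmless when S    *)
(* generates W, see cox_lengthP.                                              *)
Definition cox_length (W : finGroupType) (S : {set W}) (w : W) : nat :=
  find (fun n => w \in S ^+ n) (iota 0 #|W|).

Lemma expgs_prod (W : finGroupType) (S : {set W}) n :
  S ^+ n = \prod_(i < n) S.
Proof. by rewrite big_const card_ord /natexp Monoid.iteropE. Qed.

Lemma mem_expgs_shorten (W : finGroupType) (S : {set W}) (w : W) n :
  #|W| <= n -> w \in S ^+ n -> exists2 m, m < n & w \in S ^+ m.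
Proof.
move=> leWn; rewrite expgs_prod => /prodsgP[c Sc ->].
pose c' i := if insub i is Some j then c j else 1.
have Sc' i : i < n -> c' i \in S.
  by move=> lt_in; rewrite /c' insubT; apply: Sc.
have Sseg a b : b <= n -> \prod_(a <= i < b) c' i \in S ^+ (b - a).
  move=> le_bn; rewrite expgs_prod -{1}[a]add0n big_addn big_mkord.
  apply: mem_prodg => i _; apply: Sc'.
  by apply: leq_trans le_bn; rewrite addnC -ltn_subRL.
have -> : \prod_i c i = \prod_(0 <= i < n) c' i.
  by rewrite big_mkord; apply: eq_bigr => i _; rewrite /c' valK.
pose p (k : 'I_n.+1) := \prod_(0 <= i < k) c' i.
have /injectivePn[j0 [k0 neq_jk eq_p]] : ~~ injectiveb p.
  apply/negP=> /injectiveP/leq_card; rewrite card_ord.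
  by rewrite ltnNge leWn.
wlog lt_jk : j0 k0 neq_jk eq_p / j0 < k0.
  move=> IH; case: (ltngtP j0 k0) => [lt|lt|/val_inj eq_jk].
  - exact: IH lt.
  - by apply: IH lt; rewrite 1?eq_sym.
  - by rewrite eq_jk eqxx in neq_jk.
have le_kn : k0 <= n by rewrite -ltnS.
exists (j0 + (n - k0)); first by rewrite -[X in _ < X](subnKC le_kn) ltn_add2r.
rewrite (@big_cat_nat _ _ _ k0) //= -[X in X * _]/(p k0) -eq_p expgD mem_mulg //.
  by rewrite -[j0 in S ^+ j0]subn0 Sseg // (leq_trans (ltnW lt_jk)).
exact: Sseg.
Qed.

Lemma cox_lengthP (W : finGroupType) (S : {set W}) (w : W) :
  <<S>> = [set: W] ->
  w \in S ^+ cox_length S w /\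
  (forall n, w \in S ^+ n -> cox_length S w <= n).
Proof.
move=> genS; pose P n := w \in S ^+ n.
have exP : exists n, P n.
  have /gen_prodgP[n [c Sc def_w]] : w \in <<S>> by rewrite genS inE.
  by exists n; rewrite /P def_w expgs_prod mem_prodg.
have [m Pm min_m] := ex_minnP exP.
have lt_m : m < #|W|.
  rewrite ltnNge; apply/negP=> /mem_expgs_shorten/(_ Pm)[k lt_km Pk].
  by have := min_m k Pk; rewrite leqNgt lt_km.
have hasP : has P (iota 0 #|W|).
  by apply/hasP; exists m; rewrite ?mem_iota.
split; last move=> n Pn; rewrite /cox_length -/P.
  have := nth_find 0 hasP; rewrite nth_iota //.
  by move: hasP; rewrite has_find size_iota.
rewrite leqNgt; apply/negP=> lt_n.
have := before_find 0 lt_n; rewrite nth_iota ?add0n /P ?Pn //.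
by rewrite (leq_trans lt_n) // -[X in _ <= X](size_iota 0) find_size.
Qed.

Section TwistedGroup.

Variables (W : finGroupType) (S : {set W}) (delta : {perm W}).
Hypothesis autD : delta \in Aut [set: W].

Lemma cycle_sub_Aut : <[delta]> \subset Aut [set: W].
Proof. by rewrite cycle_subG. Qed.

Definition twist_act : groupAction <[delta]> [set: W] :=
  ([Aut [set: W]] \ cycle_sub_Aut)%gact.

(* <delta> |>< W. Permutations act on the right in MathComp, so that here     *)
(* delta^-1 * w * delta = delta(w); as the cyclic group generated by delta is *)
(* also generated by delta^-1, exchanging the two recovers the convention     *)
(* delta * w * delta^-1 = delta(w) and does not affect the other definitions. *)
Definition twisted : finGroupType := sdprod_groupType twist_act.

Definition inW (w : W) : twisted := sdpair1 twist_act w.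
Definition inDelta (a : {perm W}) : twisted := sdpair2 twist_act a.

(* u = inDelta u.1 * inW u.2 by sdpairE. *)
Definition tw_length (u : twisted) : nat := cox_length S u.2.

Lemma tw_lengthE k w :
  tw_length (inDelta (delta ^+ k) * inW w) = cox_length S w.
Proof.
rewrite /tw_length /= !val_insubd !inE !group1 mem_cycle /=.
by rewrite (act1 twist_act) mul1g.
Qed.

Lemma inW_act w : inW (delta w) = inW w ^ inDelta delta.
Proof. by rewrite -sdpair_act ?inE ?cycle_id. Qed.

Definition is_conj_class (O : {set twisted}) : Prop :=
  exists u : twisted, O = [set inW x * u * (inW x)^-1 | x : W].

Definition min_length (O : {set twisted}) : {set twisted} :=
  [set u in O | [forall v in O, tw_length u <= tw_length v]].

Definition cyc_shift_step : rel twisted := fun u v =>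
  [exists s in S, v == inW s * u * inW s] && (tw_length v <= tw_length u).

(* [connect] is the reflexive transitive closure. *)
Definition cyc_shift : rel twisted := connect cyc_shift_step.

Definition elem_strong_conj : rel twisted := fun u v =>
  (tw_length u == tw_length v) &&
  [exists x : W, (v == inW x * u * (inW x)^-1) &&
     ((tw_length (inW x * u) == cox_length S x + tw_length u) ||
      (tw_length (u * (inW x)^-1) == cox_length S x + tw_length u))].

Definition strong_conj : rel twisted := connect elem_strong_conj.

End TwistedGroup.

(* Main.v *)
(* A finite Coxeter group acts on a Euclidean space V, its elements x         *)
(* correspond to the chambers C = xC0, and the length of x^-1 g x is the      *)
(* number of walls that separate C from gC.                                   *)
(* Conjugation by simple reflections is the passage to an adjacent chamber.   *)
(* Following He and Nie, let C flow so as to increase the Rayleigh quotient   *)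
(* of the self-adjoint operator g + g^-1: when the flow crosses a wall, gC or *)
(* g^-1C lies beyond that wall, so that the length does not increase. The     *)
(* flow brings every chamber next to a regular point of the eigenspace E of   *)
(* the largest eigenvalue; instead of solving the differential equation, one  *)
(* maximises the Rayleigh quotient over the closures of the chambers that can *)
(* be reached, and recurses on the walls orthogonal to v and gv, for v a      *)
(* maximum. Two chambers next to the same regular point of E differ only by   *)
(* walls containing E, and induction on the set of walls applies to them.     *)
(* Chambers next to neighbouring regular components of E, in the same         *)
(* position with respect to the walls containing E, are strongly conjugate:   *)
(* as g acts on E by rotations of a single angle, if v lies on the wall       *)
(* between them, then gv and g^-1v lie on opposite sides of it. Hence any two *)
(* chambers flow to strongly conjugate ones, which gives both statements.     *)

Require Import Defs.
From HB Require Import structures.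
From mathcomp Require Import all_boot all_fingroup.
From mathcomp Require Import all_order all_algebra ring lra Rstruct.
From mathcomp Require Import all_classical all_reals all_analysis.
From Stdlib Require Import Relation_Operators Operators_Properties.

Set Implicit Arguments.
Unset Strict Implicit.
Unset Printing Implicit Defensive.
Import Order.TTheory GRing.Theory Num.Theory.
Import numFieldNormedType.Exports.

(** Fix an element of the class, acting on V by the isometry [tw]. The chamber with [label] w stands
    for the conjugate by w^-1, with component [tw_conj w] in W, whose length counts the walls
    between the chamber and its image. Thus [step]s between chambers give cyclic shifts
    ([step_label]). A [strong_link], where an image chamber lies on a geodesic, gives a strong
    conjugation, because lengths add when no wall is crossed twice ([len_add], [link_label]). This
    dictionary between lengths and sides of walls rests on [root_pos], proved in the geometric
    representation that the presentation provides ([ex_rep]).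

    The core is [confluence], about an isometry g of any finite g-stable arrangement: two arbitrary
    chambers can be brought by steps to linked ones. Let k be the maximum of the Rayleigh quotient
    of g + g^-1 on the span of the normals, and E the eigenspace of k. By [reach_eigen] every
    chamber can step to one next to a point z of E that lies only on walls containing E. Such a
    chamber is given by independent data: the region of z in E, and a position with respect to the
    walls containing E ([matches]). The second is handled by induction, since galleries among these
    walls can be replayed next to z ([lift_reach], [lift_linked]). The first can be changed by
    strong links, because g acts on E with a single angle ([strong_shift], [linked_shift]).

    For (1), apply this to w and a minimal m: both shift to elements that are strongly conjugate,
    hence of equal length, at most that of m. For (2), shifts that start at a minimal element keep
    the length, and such shifts are strong conjugations ([shift_strong]). *)

(** * Maximum of a Rayleigh quotient on a closed cone *)

Section Maximum.
Local Open Scope ring_scope.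
Local Open Scope classical_set_scope.
Variables (R : realType) (n : nat).
Local Notation V := 'rV[R]_n.

Lemma sum_continuous (T : topologicalType) (I : Type) (r : seq I) (F : I -> T -> R) :
  (forall i, continuous (F i)) -> continuous (fun v => \sum_(i <- r) F i v).
Proof.
move=> cF; elim: r => [|i r IH] v.
  under eq_fun do rewrite big_nil; exact: cst_continuous.
under eq_fun do rewrite big_cons; apply: cvgD; [exact: cF | exact: IH].
Qed.

Lemma linear_form_continuous (f : V -> R) :
  (forall x y, f (x + y) = f x + f y) -> (forall a x, f (a *: x) = a * f x) ->
  continuous f.
Proof.
move=> fD fZ.
have f0 : f 0 = 0 by rewrite -(scale0r 0) fZ mul0r.
have -> : f = fun v => \sum_i v 0 i * f (delta_mx 0 i).
  apply/funext => v; rewrite {1}(row_sum_delta v).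
  by rewrite (big_morph f fD f0); apply: eq_bigr => i _; rewrite fZ.
apply: sum_continuous => i v; apply: continuousM; last exact: cst_continuous.
exact: (@coord_continuous R 1 n 0 i v).
Qed.

Lemma quadratic_form_continuous (f : V -> V -> R) :
  (forall x y z, f (x + y) z = f x z + f y z) ->
  (forall a x z, f (a *: x) z = a * f x z) ->
  (forall x y z, f z (x + y) = f z x + f z y) ->
  (forall a x z, f z (a *: x) = a * f z x) ->
  continuous (fun v => f v v).
Proof.
move=> fDl fZl fDr fZr.
have f0 v : f 0 v = 0 by rewrite -(scale0r 0) fZl mul0r.
have -> : (fun v => f v v) = fun v : V => \sum_i v 0 i * f (delta_mx 0 i) v.
  apply/funext => v; rewrite {1}(row_sum_delta v).
  rewrite (big_morph (f^~ v) (fun x y => fDl x y v) (f0 v)).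
  by apply: eq_bigr => i _; rewrite fZl.
apply: sum_continuous => i v; apply: continuousM; last exact: linear_form_continuous.
exact: (@coord_continuous R 1 n 0 i v).
Qed.

(** The quotient is invariant under scaling, so it is enough to maximise [f] on the part of [P]
    where b v v = 1. This set is closed, and the bound on coordinates puts it in a cube, so it is
    compact. *)
Lemma max_rayleigh (b f : V -> V -> R) (P : set V) :
  (forall x y z, b (x + y) z = b x z + b y z) ->
  (forall a x z, b (a *: x) z = a * b x z) ->
  (forall x y, b x y = b y x) ->
  (forall (v : V) i, (v 0 i) ^+ 2 <= b v v) ->
  (forall x y z, f (x + y) z = f x z + f y z) ->
  (forall a x z, f (a *: x) z = a * f x z) ->
  (forall x y z, f z (x + y) = f z x + f z y) ->
  (forall a x z, f z (a *: x) = a * f z x) ->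
  closed P -> (forall a v, 0 < a -> P v -> P (a *: v)) ->
  (exists2 v, P v & v != 0) ->
  exists v, [/\ P v, v != 0 & forall u, P u -> f u u * b v v <= f v v * b u u].
Proof.
move=> bDl bZl bC bco fDl fZl fDr fZr clP coneP [v0 Pv0 v0N0].
have bDr x y z : b z (x + y) = b z x + b z y by rewrite bC bDl !(bC z).
have bZr a x z : b z (a *: x) = a * b z x by rewrite bC bZl !(bC z).
have bpos (v : V) : v != 0 -> 0 < b v v.
  move=> vN0; have [i vi] : exists i, v 0 i != 0.
    by apply/existsP; apply: contraNT vN0 => /existsPn h; apply/eqP/rowP=> i;
      rewrite mxE; apply/eqP/negPn/h.
  by apply: lt_le_trans (bco v i); rewrite exprn_even_gt0.
pose A := P `&` [set v | b v v = 1].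
have normA v : v != 0 -> P v -> A ((Num.sqrt (b v v))^-1 *: v).
  move=> vN0 Pv; have bv := bpos _ vN0; split.
    by apply: coneP => //; rewrite invr_gt0 sqrtr_gt0.
  rewrite /= bZl bZr mulrA -expr2 exprVn sqr_sqrtr ?(ltW bv) //.
  by rewrite mulVf // gt_eqF.
have clA : closed A.
  apply: closedI => //.
  have /continuous_closedP cb : continuous (fun v : V => b v v).
    exact: quadratic_form_continuous.
  exact: (cb [set x : R | x = 1] (@closed_eq R 1)).
have cA : compact A.
  apply: (@subclosed_compact _ A
    [set v : V | forall i, (`[(-1), 1]%classic) (v ord0 i)]) => //.
    apply: (@rV_compact _ _ (fun _ : 'I_n => `[(-1 : R), 1]%classic)) => i.
    exact: segment_compact.
  move=> v [_ /= bv] i /=; rewrite in_itv /= -ler_norml.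
  by rewrite -(@expr_le1 _ 2) // -normrX ger0_norm ?sqr_ge0 // -bv.
have [v /set_mem[Pv bv] vmax] : exists2 c, c \in A &
    forall t, t \in A -> f t t <= f c c.
  apply: (@EVT_max_rV R n (fun v => f v v) A) => //.
    by exists ((Num.sqrt (b v0 v0))^-1 *: v0); apply: normA.
  by apply: continuous_subspaceT; exact: quadratic_form_continuous.
have vN0 : v != 0.
  apply/eqP => v0'; move: bv; rewrite /= v0' -(scale0r 0) bZl mul0r => /eqP.
  by rewrite eq_sym oner_eq0.
exists v; split=> // u Pu; rewrite bv mulr1.
have [->|uN0] := eqVneq u 0.
  by rewrite -(scale0r 0) fZl bZl !mul0r mulr0.
have := vmax _ (mem_set (normA _ uN0 Pu)).
have bu := bpos _ uN0.
rewrite fZl fZr mulrA -expr2 exprVn sqr_sqrtr ?(ltW bu) // mulrC.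
by rewrite ler_pdivrMr.
Qed.

End Maximum.

(** * Isometries of hyperplane arrangements *)

Section Small.
Local Open Scope ring_scope.
Variable R : realFieldType.

Lemma small_fin (I : finType) (P : I -> R -> Prop) :
  (forall i, exists2 h0, 0 < h0 & forall h, 0 < h <= h0 -> P i h) ->
  exists2 h0, 0 < h0 & forall h, 0 < h <= h0 -> forall i, P i h.
Proof.
move=> hP; suff [h0 h0p hh] : exists2 h0, 0 < h0 &
    forall h, 0 < h <= h0 -> forall i, i \in enum I -> P i h.
  by exists h0 => // h hlt i; apply: hh => //; rewrite mem_enum.
elim: (enum I) => [|i s [h0 h0p IH]]; first by exists 1.
have [h1 h1p hi] := hP i; exists (Num.min h0 h1); first by rewrite lt_min h0p.
move=> h; rewrite le_min => /and3P[hp hl0 hl1] j; rewrite inE => /predU1P[->|js].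
  by apply: hi; rewrite hp.
by apply: IH => //; rewrite hp.
Qed.

Lemma gt0_mul_side (a q : R) : 0 < a * q -> q != 0 /\ (0 < q) = (0 < a).
Proof.
move=> aq; have q0 : q != 0 by apply: contraTneq aq => ->; rewrite mulr0 ltxx.
by split=> //; case: (ltrgt0P q) q0 aq => // q0 _;
  rewrite ?(pmulr_lgt0 _ q0) ?(nmulr_lgt0 _ q0) // => /ltW; rewrite leNgt => /negbTE.
Qed.

Lemma lt0_mul_side (a q : R) : a * q < 0 -> q != 0 /\ (0 < q) = ~~ (0 < a).
Proof.
rewrite -oppr_gt0 -mulrN => /gt0_mul_side[q0 <-]; rewrite oppr_eq0 in q0.
by split=> //; rewrite oppr_gt0 -leNgt le0r eq_sym eq_le; case: ltrgt0P q0.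
Qed.

Lemma avoid_seq (s : seq R) (lo hi : R) :
  lo < hi -> exists2 t, lo < t < hi & t \notin s.
Proof.
elim: s hi => [|a s IH] hi lt_lh.
  by exists ((lo + hi) / 2) => //; rewrite !midf_lt.
have [t /andP[lot thi] ts] := IH _ lt_lh.
have [ta|ta] := eqVneq t a; last by exists t; rewrite ?lot // inE negb_or ta.
have [u /andP[lou uhi] us] := IH _ lot.
exists u; first by rewrite lou (lt_trans uhi).
by rewrite inE negb_or us -ta lt_eqF.
Qed.

End Small.

(** * Sides of walls and infinitely near points *)

Section Arrangement.
Local Open Scope ring_scope.
Variables (R : realFieldType) (V : lmodType R) (b : V -> V -> R).
Hypothesis bDl : forall x y z, b (x + y) z = b x z + b y z.
Hypothesis bZl : forall a x z, b (a *: x) z = a * b x z.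
Hypothesis bC : forall x y, b x y = b y x.
Hypothesis bpos : forall x, x != 0 -> 0 < b x x.
Variables (I : finType) (e : I -> V).
Hypothesis eN0 : forall i, e i != 0.

Lemma bDr x y z : b z (x + y) = b z x + b z y.
Proof. by rewrite bC bDl !(bC z). Qed.
Lemma bZr a x z : b z (a *: x) = a * b z x.
Proof. by rewrite bC bZl (bC z). Qed.
Lemma b0l z : b 0 z = 0. Proof. by rewrite -(scale0r 0) bZl mul0r. Qed.
Lemma b0r z : b z 0 = 0. Proof. by rewrite bC b0l. Qed.
Lemma bNl x z : b (- x) z = - b x z.
Proof. by rewrite -scaleN1r bZl mulN1r. Qed.
Lemma bNr x z : b z (- x) = - b z x.
Proof. by rewrite bC bNl bC. Qed.
Definition bE := (bDl, bDr, bNl, bNr, bZl, bZr, b0l, b0r).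

Lemma b_eq0 x : b x x = 0 -> x = 0.
Proof. by move=> bx; apply/eqP; apply: contraT => /bpos; rewrite bx ltxx. Qed.

Lemma b_ge0 x : 0 <= b x x.
Proof. by have [->|/bpos/ltW //] := eqVneq x 0; rewrite b0l. Qed.

(* The walls are the hyperplanes e i = 0. The normals e i are not oriented and *)
(* may be repeated up to a scalar: all notions below only compare sides. A     *)
(* chamber is represented by any regular vector that it contains.              *)
Definition side x i := 0 < b x (e i).
Definition separates x y i := side x i != side y i.
Definition regular (J : {set I}) x := forall i, i \in J -> b x (e i) != 0.
Definition parallel (a c : V) := exists k, a = k *: c.
(* v is in the closure of the chamber of x, for x regular *)
Definition adherent (J : {set I}) v x := forall i, i \in J -> b v (e i) != 0 ->
  side x i = side v i.
(* y is on the side of v, or on that of z when v is on the wall: up to the     *)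
(* choice of y, this is the infinitely near point v + 0+ z.                    *)
Definition lexicographic v z y i :=
  if b v (e i) == 0 then ((b y (e i) == 0) = (b z (e i) == 0)) /\ side y i = side z i
  else b y (e i) != 0 /\ side y i = side v i.

Lemma small_lexicographic v z :
  exists2 h0, 0 < h0 & forall h, 0 < h <= h0 -> forall i, lexicographic v z (v + h *: z) i.
Proof.
apply: small_fin => i; rewrite /lexicographic /side.
have [v0|vN0] := eqVneq (b v (e i)) 0.
  exists 1 => // h /andP[h0 _]; rewrite !bE v0 add0r.
  by rewrite mulf_eq0 gt_eqF // pmulr_rgt0.
set a := b v (e i); set c := b z (e i) in vN0 *.
have a0 : 0 < `|a| by rewrite normr_gt0.
have c0 : 0 < `|c| + 1 by rewrite ltr_wpDl.
exists (`|a| / (`|c| + 1)); first by rewrite divr_gt0.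
move=> h /andP[h0]; rewrite ler_pdivlMr // => hle; rewrite !bE -/a -/c.
have hc : `|h * c| < `|a|.
  by rewrite normrM (gtr0_norm h0); nra.
move: hc; rewrite ltr_norml; case: (ltrgt0P a) vN0 => // a1 _.
  by move=> /andP[h1 h2]; split; [rewrite gt_eqF | apply/idP]; lra.
by move=> /andP[h1 h2]; split; [rewrite lt_eqF | apply/negbTE; rewrite -leNgt]; lra.
Qed.

Lemma ex_lexicographic v z : exists y, forall i, lexicographic v z y i.
Proof.
have [h0 h0p hh] := small_lexicographic v z.
by exists (v + h0 *: z); apply: hh; rewrite h0p lexx.
Qed.

(** * Galleries inside a linear subspace *)

Section Gallery.
Variables (E : V -> Prop) (J : {set I}).
Hypothesis Elin : forall a x y, E x -> E y -> E (a *: x + y).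

(** For walls that do not contain E, this means that both have the same trace on E. *)
Definition ker_incl i j := forall z, E z -> b z (e i) = 0 -> b z (e j) = 0.

(* Perturbing x makes the segment from x to y cross two walls with distinct    *)
(* traces on E at distinct times, so a point between them is closer to x.      *)
Lemma gallery1 x y : E x -> E y -> regular J x -> regular J y ->
  (exists2 i, i \in J & separates x y i) ->
  exists x', [/\ E x', regular J x', exists2 i, i \in J & separates x x' i,
    forall i, i \in J -> separates x x' i -> separates x y i &
    {in J &, forall i j, separates x x' i -> separates x x' j -> ker_incl i j}].
Proof.
move=> Ex Ey rx; have [m] := ubnP #|[set i in J | separates x y i]|.
elim: m y Ey => // m IH y Ey; rewrite ltnS => lem ry [i0 Ji0 si0].
have [allk|] := pselect {in J &, forall i j, separates x y i -> separates x y j ->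
  ker_incl i j}.
  by exists y; split=> //; exists i0.
move=> /existsNP[i] /existsNP[j] /not_implyP[Ji] /not_implyP[Jj].
move=> /not_implyP[si] /not_implyP[sj] /existsNP[z] /not_implyP[Ez].
move=> /not_implyP[zi /eqP zj].
set xi := b x (e i); set yi := b y (e i); set xj := b x (e j); set yj := b y (e j).
have sepM w w' k : b w (e k) != 0 -> b w' (e k) != 0 -> separates w w' k ->
    b w (e k) * b w' (e k) < 0.
  rewrite /separates /side => w0 w0'.
  case: (ltrgt0P (b w (e k))) w0 => // h1 _;
    case: (ltrgt0P (b w' (e k))) w0' => // h2 _ _; nra.
have [x1 [Ex1 rx1 x1x neq]] : exists x1, [/\ E x1, regular J x1,
    forall k, k \in J -> side x1 k = side x k & b x1 (e i) * yj != b x1 (e j) * yi].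
  have [eqx|neqx] := eqVneq (xi * yj) (xj * yi); last by exists x.
  have [h0 h0p hh] := small_lexicographic x z.
  have {hh} hh k : k \in J -> b (x + h0 *: z) (e k) != 0 /\ side (x + h0 *: z) k = side x k.
    move=> Jk; have := hh h0; rewrite h0p lexx => /(_ isT k).
    by rewrite /lexicographic (negbTE (rx _ Jk)).
  exists (x + h0 *: z); split=> [|k Jk|k Jk|]; first by rewrite addrC; apply: Elin.
  - by have [] := hh k Jk.
  - by have [] := hh k Jk.
  rewrite !bE zi mulr0 addr0 -/xi -/xj eqx -subr_eq0.
  rewrite (_ : _ - _ = - (h0 * b z (e j) * yi)); last by ring.
  by rewrite oppr_eq0 !mulf_eq0 !negb_or zj gt_eqF //=; exact: ry Ji.
have six : separates x1 y i by rewrite /separates x1x.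
have sjx : separates x1 y j by rewrite /separates x1x.
(* The time at which the segment from [x1] to [y] meets a wall [k] that separates them. *)
pose T k := b x1 (e k) / (b x1 (e k) - b y (e k)).
have Tprop k : k \in J -> separates x1 y k -> forall t, 0 <= t <= 1 ->
   let p := (1 - t) * b x1 (e k) + t * b y (e k) in
   (t < T k -> b x1 (e k) * p > 0) /\ (T k < t -> b x1 (e k) * p < 0).
  move=> Jk sk t /andP[t0 t1]; have := sepM _ _ _ (rx1 _ Jk) (ry _ Jk) sk.
  rewrite /T; set u := b x1 (e k); set v := b y (e k) => uv.
  have [u0|u0|u0] := ltrgt0P u; last by rewrite u0 mul0r ltxx in uv.
    have v0 : v < 0 by nra.
    have uv0 : 0 < u - v by lra.
    by split; rewrite ?ltr_pdivlMr ?ltr_pdivrMr // => h; nra.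
  have v0 : v > 0 by nra.
  have uv0 : 0 < v - u by lra.
  rewrite -(opprB v u) invrN mulrN -mulNr.
  by split; rewrite ?ltr_pdivlMr ?ltr_pdivrMr // => h; nra.
have T01 k : k \in J -> separates x1 y k -> 0 < T k < 1.
  move=> Jk sk; have := sepM _ _ _ (rx1 _ Jk) (ry _ Jk) sk.
  rewrite /T; set u := b x1 (e k); set v := b y (e k) => uv.
  have [u0|u0|u0] := ltrgt0P u; last by rewrite u0 mul0r ltxx in uv.
    have v0 : v < 0 by nra.
    have uv0 : 0 < u - v by lra.
    by rewrite divr_gt0 //= ltr_pdivrMr //; lra.
  have v0 : v > 0 by nra.
  have uv0 : 0 < v - u by lra.
  rewrite -(opprB v u) invrN mulrN -mulNr divr_gt0 ?oppr_gt0 //=.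
  by rewrite ltr_pdivrMr //; lra.
have Tij : T i != T j.
  rewrite /T eqr_div ?subr_eq0; last 2 first.
  - by apply: contraNneq six => h; rewrite /separates /side h eqxx.
  - by apply: contraNneq sjx => h; rewrite /separates /side h eqxx.
  rewrite !mulrBr [b x1 (e j) * b x1 (e i)]mulrC (inj_eq (addrI _)) eqr_opp.
  exact: neq.
have [k1 [k2 [Jk1 Jk2 sk1 sk2 lt12]]] : exists k1 k2,
    [/\ k1 \in J, k2 \in J, separates x1 y k1, separates x1 y k2 & T k1 < T k2].
  by case: (ltrgtP (T i) (T j)) Tij => // h _; [exists i, j | exists j, i].
have [t /andP[t1 t2] tns] := avoid_seq [seq T k | k <- enum I] lt12.
have /andP[T10 _] := T01 _ Jk1 sk1; have /andP[_ T21] := T01 _ Jk2 sk2.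
have t01 : 0 <= t <= 1 by lra.
pose p := (1 - t) *: x1 + t *: y.
have pE k : b p (e k) = (1 - t) * b x1 (e k) + t * b y (e k) by rewrite !bE.
have tTk k : t != T k.
  by apply: contraNneq tns => ->; apply/mapP; exists k; rewrite ?mem_enum.
have pP k : k \in J -> b p (e k) != 0 /\
    (if separates x1 y k then separates x1 p k = (T k < t) else separates x1 p k = false).
  move=> Jk; rewrite /separates /side pE; case: ifP => [sk|].
    have [h1 h2] := Tprop k Jk sk t t01.
    case: (ltrgtP t (T k)) (tTk k) => // h _.
      by have [q0 ->] := gt0_mul_side (h1 h); rewrite q0 eqxx.
    have [q0 ->] := lt0_mul_side (h2 h); rewrite q0; split=> //.
    by case: (0 < _).
  move/negbFE/eqP => eqs; set q := (X in X != 0).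
  case: (ltrgt0P (b x1 (e k))) (rx1 k Jk) eqs => // h1 _.
    move/esym=> h2; have q0 : 0 < q by rewrite /q; nra.
    by rewrite q0 gt_eqF.
  move/esym/negbT; rewrite -leNgt => h2; have := ry k Jk => h3.
  have h4 : b y (e k) < 0 by rewrite lt_neqAle h3.
  have q0 : q < 0 by rewrite /q; nra.
  by rewrite lt_eqF // [0 < q]ltNge ltW.
have Ep : E p.
  apply: Elin => //; rewrite -[t *: y]addr0; apply: Elin => //.
  by rewrite -(addNr x1) -scaleN1r; apply: Elin.
have rp : regular J p by move=> k /pP[].
have sxp k : k \in J -> separates x p k = separates x1 p k by move=> Jk;
  rewrite /separates x1x.
have sxy k : k \in J -> separates x1 y k = separates x y k by move=> Jk;
  rewrite /separates x1x.
have sub k : k \in J -> separates x p k -> separates x y k.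
  by move=> Jk; rewrite sxp // -sxy //; have [_] := pP k Jk; case: ifP => // _ ->.
have lt_p : (#|[set i in J | separates x p i]| < m)%N.
  apply: leq_trans lem; apply: proper_card; apply/properP; split.
    by apply/fintype.subsetP=> k; rewrite !inE => /andP[Jk /(sub _ Jk) ->]; rewrite Jk.
  exists k2; rewrite !inE ?Jk2 -?sxy //= sxp //.
  by have [_] := pP k2 Jk2; rewrite sk2 => ->; rewrite -leNgt ltW.
have ne_p : exists2 i, i \in J & separates x p i.
  by exists k1; rewrite ?sxp //; have [_] := pP k1 Jk1; rewrite sk1 t1.
have [x' [Ex' rx' ne' sub' kin']] := IH p Ep lt_p rp ne_p.
exists x'; split=> // k Jk /(sub' _ Jk); exact: sub.
Qed.

(** Each use of [gallery1] removes a wall that separates the current point from [y]. Several walls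
    may be crossed at once when they have the same trace on E. *)
Lemma gallery_ind (y : V) (Q : V -> Prop) :
  E y -> regular J y ->
  (forall x, E x -> regular J x -> (forall i, i \in J -> ~~ separates x y i) -> Q x) ->
  (forall x x', E x -> regular J x -> E x' -> regular J x' ->
     (exists2 i, i \in J & separates x x' i) ->
     (forall i, i \in J -> separates x x' i -> separates x y i) ->
     {in J &, forall i j, separates x x' i -> separates x x' j -> ker_incl i j} ->
     Q x' -> Q x) ->
  forall x, E x -> regular J x -> Q x.
Proof.
move=> Ey ry Q0 Q1 x; have [m] := ubnP #|[set i in J | separates x y i]|.
elim: m x => // m IH x; rewrite ltnS => lem Ex rx.
have [ne|ne] := pselect (exists2 i, i \in J & separates x y i); last first.
  by apply: Q0 => // i Ji; apply/negP => si; apply: ne; exists i.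
have [x' [Ex' rx' [i Ji si] sub kk]] := gallery1 Ex Ey rx ry ne.
apply: (Q1 x x') => //; first by exists i.
apply: IH => //; apply: leq_trans lem; apply: proper_card; apply/properP; split.
  apply/fintype.subsetP=> k; rewrite !inE => /andP[Jk sk]; rewrite Jk /=.
  apply: contraT => nk; have := sub k Jk; move: sk nk; rewrite /separates.
  by case: (side x k); case: (side x' k); case: (side y k) => // _ _ /(_ isT).
exists i; rewrite !inE Ji /= ?sub //; have := sub i Ji si; move: si; rewrite /separates.
by case: (side x i); case: (side x' i); case: (side y i).
Qed.

End Gallery.

(** The component of [e j] orthogonal to [e i] lies on the wall i, hence on the wall j, so it is
    orthogonal to itself. *)
Lemma ker_incl_parallel i j : ker_incl (fun=> True) i j -> parallel (e j) (e i).
Proof.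
move=> k; have bi := bpos (eN0 i).
exists (b (e j) (e i) / b (e i) (e i)); apply/eqP; rewrite -subr_eq0; apply/eqP.
set w := _ - _; have wi : b w (e i) = 0 by rewrite /w !bE mulrVK ?unitfE ?gt_eqF // subrr.
by apply: b_eq0; rewrite {2}/w bDr bNr bZr wi (k _ _ wi) // mulr0 subr0.
Qed.

(** * Steps between chambers for an isometry g *)

Variables (g gi : V -> V).

Definition stable_by (h : V -> V) (J : {set I}) := forall i, i \in J ->
  exists j c, [/\ j \in J, c != 0 & forall x, b (h x) (e i) = c * b x (e j)].
Definition stable J := stable_by g J /\ stable_by gi J.

(* If x is next to the wall i, then by crossing this wall one cannot increase  *)
(* the number of walls that separate x from g x.                               *)
Definition crossable x i :=
  [\/ separates x (g x) i, separates x (gi x) i | parallel (g (e i)) (e i)].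
(** One geometric wall may carry several indices. The case where no wall at all is crossed is
    allowed. *)
Definition single_wall (J : {set I}) x y :=
  {in J &, forall i j, separates x y i -> separates x y j -> parallel (e i) (e j)}.
Definition step (J : {set I}) x y :=
  [/\ regular J x, regular J y, single_wall J x y & forall i, i \in J ->
    separates x y i -> crossable x i].
Definition reach J := clos_refl_trans V (step J).

Lemma side_scale (c a : R) : c != 0 -> a != 0 -> (0 < c * a) = ((0 < c) == (0 < a)).
Proof.
move=> c0 a0; case: (ltrgt0P c) c0 => // hc _.
  by rewrite pmulr_rgt0 //; case: (0 < a).
by rewrite nmulr_rgt0 //; case: (ltrgt0P a) a0.
Qed.

Lemma stable_same h J x y : stable_by h J -> regular J x -> regular J y ->
  (forall i, i \in J -> side x i = side y i) ->
  forall i, i \in J -> side (h x) i = side (h y) i.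
Proof.
move=> sJ rx ry hs i /sJ[j [c [Jj c0 E]]]; rewrite /side !E !side_scale ?rx ?ry //.
by rewrite -/(side x j) -/(side y j) hs.
Qed.

Lemma stable_adherent h J v x : stable_by h J -> regular J x -> adherent J v x ->
  adherent J (h v) (h x).
Proof.
move=> sJ rx cv i /sJ[j [c [Jj c0 E]]]; rewrite /side !E mulf_eq0 negb_or.
by case/andP=> _ v0; rewrite !side_scale ?rx // -/(side x j) cv.
Qed.

Lemma reach_regular J x y : reach J x y -> regular J x -> regular J y.
Proof. by elim=> [? ? [] | //|? ? ? _ h1 _ h2 /h1/h2]. Qed.

Lemma parallel_separates x y i j : parallel (e i) (e j) ->
  b x (e j) != 0 -> b y (e j) != 0 -> separates x y i = separates x y j.
Proof.
move=> [k Ek] x0 y0; have k0 : k != 0.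
  by apply: contraTneq (eN0 i) => k0; rewrite Ek k0 scale0r eqxx.
rewrite /separates /side Ek !bE !side_scale //.
by case: (0 < k); case: (0 < b x _); case: (0 < b y _).
Qed.

(* When v is in the closures of two chambers separated by the wall i, this     *)
(* makes i crossable towards the side s.                                       *)
Definition crossable_from v s i :=
  (b (g v) (e i) != 0 /\ side (g v) i = s) \/ (b (gi v) (e i) != 0 /\ side (gi v) i = s).

(* A gallery from x to y near v: the walls outside K are crossable because of  *)
(* v, and the single wall in K because of x.                                   *)
Lemma reach_crossing (J K : {set I}) v x y :
  stable J -> stable K -> K \subset J -> regular J x -> regular J y ->
  adherent J v x -> adherent J v y ->
  (forall i, i \in K -> separates x y i -> crossable x i) -> single_wall K x y ->
  (forall i, i \in J -> i \notin K -> separates x y i -> crossable_from v (side y i) i) ->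
  reach J x y.
Proof.
move=> sJ sK /fintype.subsetP KJ rx ry cx cy gK oK fJ.
pose Q x' := (forall i, i \in J -> separates x' y i -> separates x y i) -> reach J x' y.
suff: Q x by apply.
apply: (@gallery_ind (fun=> True) J _ y Q) => //.
  move=> x' _ rx' ns _; apply: rt_step; split=> //; last first.
    by move=> i Ji; rewrite (negbTE (ns i Ji)).
  by move=> i j Ji _; rewrite (negbTE (ns i Ji)).
move=> x' x'' _ rx' _ rx'' _ sub kk IH sub'.
have sub'' i : i \in J -> separates x'' y i -> separates x' y i.
  move=> Ji; have := sub i Ji; rewrite /separates.
  by case: (side x' i); case: (side x'' i); case: (side y i) => // /(_ isT).
apply: (rt_trans _ _ _ x''); last by apply: IH => i Ji /(sub'' _ Ji)/(sub' _ Ji).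
have ox : single_wall J x' x''.
  by move=> i j Ji Jj si sj; apply: ker_incl_parallel; apply: kk.
apply: rt_step; split=> // i Ji si.
have siy := sub i Ji si; have sixy := sub' i Ji siy.
have [Ki|NKi] := boolP (i \in K).
  have same j : j \in K -> side x' j = side x j.
    move=> Kj; apply/eqP; apply: contraT => nj.
    have Jj := KJ _ Kj; have := sub' _ Jj; move: nj; rewrite /separates => nj sj.
    have sxy : separates x y j.
      by move: nj sj; rewrite /separates; case: (side x' j); case: (side x j);
        case: (side y j) => // _ ->.
    have nsy : ~~ separates x' y j.
      by move: nj sxy; rewrite /separates; case: (side x' j); case: (side x j);
        case: (side y j).
    have := parallel_separates (oK _ _ Ki Kj sixy sxy) (rx' _ Jj) (ry _ Jj).
    by rewrite siy (negbTE nsy).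
  have rK z : regular J z -> regular K z by move=> rz j /KJ; apply: rz.
  case: (gK i Ki sixy) => [h|h|h]; [constructor 1|constructor 2|by constructor 3].
    by rewrite /separates same // (stable_same sK.1 (rK _ rx') (rK _ rx)).
  by rewrite /separates same // (stable_same sK.2 (rK _ rx') (rK _ rx)).
have cx' : adherent J v x'.
  move=> j Jj vj; rewrite -(cx j Jj vj); apply/eqP; apply: contraT => nj.
  have := sub' j Jj; have := cx j Jj vj; have := cy j Jj vj; move: nj; rewrite /separates.
  by case: (side x' j); case: (side x j); case: (side y j) => // _ <- // _ /(_ isT).
have [[v0 sv]|[v0 sv]] := fJ i Ji NKi sixy; [constructor 1|constructor 2].
  by rewrite /separates (stable_adherent sJ.1 rx' cx' Ji v0) sv.
by rewrite /separates (stable_adherent sJ.2 rx' cx' Ji v0) sv.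
Qed.

Lemma stable0 : stable finset.set0.
Proof. by split=> i; rewrite inE. Qed.

(* The lexicographic point "v, then u, then x" lies in a chamber whose closure *)
(* contains v + h u for all small h > 0.                                       *)
Lemma reach_push (J : {set I}) v u x : stable J -> regular J x -> adherent J v x ->
  (forall i, i \in J -> b v (e i) = 0 -> b u (e i) != 0 -> side x i != side u i ->
     crossable_from v (side u i) i) ->
  exists y, [/\ reach J x y, regular J y & exists2 h0, 0 < h0 &
    forall h, 0 < h <= h0 -> adherent J (v + h *: u) y /\
      forall i, i \in J -> b (v + h *: u) (e i) = 0 -> b v (e i) = 0 /\ b u (e i) = 0].
Proof.
move=> sJ rx cx fx.
have [w dw] := ex_lexicographic u x; have [y dy] := ex_lexicographic v w.
have rw : regular J w.
  move=> i Ji; have := dw i; rewrite /lexicographic; case: eqP => [_ [-> _]|_ []//];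
    exact: rx.
have ry : regular J y.
  move=> i Ji; have := dy i; rewrite /lexicographic; case: eqP => [_ [-> _]|_ []//];
    exact: rw.
have cy : adherent J v y.
  by move=> i Ji v0; have := dy i; rewrite /lexicographic (negbTE v0) => -[].
have s0 i : i \in J -> b v (e i) = 0 -> side y i = side w i.
  by move=> Ji v0; have := dy i; rewrite /lexicographic v0 eqxx => -[].
have su i : i \in J -> b v (e i) = 0 -> b u (e i) != 0 -> side y i = side u i.
  move=> Ji v0 u0; rewrite s0 //; have := dw i;
    by rewrite /lexicographic (negbTE u0) => -[].
exists y; split=> //.
  apply: (reach_crossing sJ stable0) (rx) (ry) (cx) (cy) _ _ _; rewrite ?finset.sub0set //.
  - by move=> i; rewrite inE.
  - by move=> i j; rewrite inE.
  move=> i Ji _ si; have v0 : b v (e i) = 0.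
    by apply/eqP; apply: contraT => v0; move: si;
      rewrite /separates (cx _ Ji v0) (cy _ Ji v0) eqxx.
  have [u0|u0] := eqVneq (b u (e i)) 0.
    by move: si; rewrite /separates s0 //; have := dw i;
      rewrite /lexicographic u0 eqxx => -[_ ->]; rewrite eqxx.
  by rewrite su //; apply: fx => //; rewrite -su.
have [h0 h0p hh] := small_lexicographic v u; exists h0 => // h hlt.
split=> i Ji; have := hh h hlt i; rewrite /lexicographic; case: eqP => [v0|/eqP v0] [].
- move=> z0 sz N0; have u0 : b u (e i) != 0 by rewrite -z0.
  by rewrite sz su.
- by move=> _ -> _; rewrite cy.
- by move=> z0 _ h1; split=> //; apply/eqP; rewrite -z0 h1.
- by move=> /eqP.
Qed.

Hypothesis gZ : forall a x, g (a *: x) = a *: g x.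
Hypothesis gD : forall x y, g (x + y) = g x + g y.
Hypothesis gK : cancel g gi.
Hypothesis giK : cancel gi g.
Hypothesis bg : forall x y, b (g x) (g y) = b x y.

(** * Chambers next to an eigenvector of g + g^-1 *)

Section Eigen.
Variables (J : {set I}) (v : V) (l : R).
Hypothesis sJ : stable J.
Hypothesis Mv : g v + gi v = l *: v.

Definition orthogonal_walls : {set I} :=
  [set i in J | (b v (e i) == 0) && (b (g v) (e i) == 0)].

Lemma giE : gi v = l *: v - g v.
Proof. by rewrite -Mv addrC addKr. Qed.

Lemma ggE : g (g v) = l *: g v - v.
Proof. by have := congr1 g Mv; rewrite gD gZ giK => <-; rewrite addrK. Qed.

Lemma stable_orthogonal : stable orthogonal_walls.
Proof.
split=> i; rewrite inE => /and3P[Ji /eqP vi /eqP gvi].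
  have [j [c [Jj c0 E]]] := sJ.1 _ Ji; exists j, c; split=> //; rewrite inE Jj /=.
  rewrite -[_ == 0](mulrI_eq0 _ (mulfI c0)) -E gvi eqxx /=.
  by rewrite -[_ == 0](mulrI_eq0 _ (mulfI c0)) -E ggE !bE gvi vi mulr0 subr0.
have [j [c [Jj c0 E]]] := sJ.2 _ Ji; exists j, c; split=> //; rewrite inE Jj /=.
rewrite -[_ == 0](mulrI_eq0 _ (mulfI c0)) -E giE !bE gvi vi mulr0 subr0 eqxx /=.
by rewrite -[_ == 0](mulrI_eq0 _ (mulfI c0)) -E gK vi.
Qed.

Lemma orthogonal_sub : orthogonal_walls \subset J.
Proof. by apply/fintype.subsetP=> i; rewrite inE => /andP[]. Qed.

(* On such a wall g v and g^-1 v have opposite nonzero coordinates, since      *)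
(* g v + g^-1 v is proportional to v.                                          *)
Lemma free_orthogonal i s : i \in J -> i \notin orthogonal_walls -> b v (e i) = 0 ->
  crossable_from v s i.
Proof.
move=> Ji; rewrite inE Ji /= => + v0; rewrite v0 eqxx /= => gv0.
rewrite /crossable_from /side giE !bE v0 mulr0 sub0r oppr_eq0 oppr_gt0.
by case: (ltrgt0P (b (g v) (e i))) gv0 => // _ _; case: s; [left|right|right|left].
Qed.

(** A gallery for the walls orthogonal to v and g v is replayed next to [v], where the other walls
    through [v] can be crossed both ways by [free_orthogonal]. Its end is on the side of [u] for the
    orthogonal walls, and [reach_push] applies. *)
Lemma reach_advance u x xk : regular J x -> adherent J v x ->
  reach orthogonal_walls x xk -> adherent orthogonal_walls u xk ->
  exists y, [/\ reach J x y, regular J y & exists2 h0, 0 < h0 &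
    forall h, 0 < h <= h0 -> adherent J (v + h *: u) y /\
      forall i, i \in J -> b (v + h *: u) (e i) = 0 -> b v (e i) = 0 /\ b u (e i) = 0].
Proof.
move=> rx cx rxk cu.
have LJ := fintype.subsetP orthogonal_sub.
have [x' [rx' gx' cx' sx']] : exists x', [/\ reach J x x', regular J x', adherent J v x' &
    forall i, i \in orthogonal_walls -> side x' i = side xk i].
  move: rxk => /clos_rt_rtn1_iff rxk; elim: rxk {cu} => [|y z [ry rz oyz gyz] _].
    by exists x; split=> //; apply: rt_refl.
  move=> [y' [ry' gy' cy' sy']].
  (* [z'] is infinitely near to [v], in the direction of [z], then of [x]. *)
  have [w dw] := ex_lexicographic z x; have [z' dz] := ex_lexicographic v w.
  have rw : regular J w.
    move=> i Ji; have := dw i; rewrite /lexicographic; case: eqP => [_ [-> _]|_ []//];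
      exact: rx.
  have rz' : regular J z'.
    move=> i Ji; have := dz i; rewrite /lexicographic; case: eqP => [_ [-> _]|_ []//];
      exact: rw.
  have cz' : adherent J v z'.
    by move=> i Ji v0; have := dz i; rewrite /lexicographic (negbTE v0) => -[].
  have sz' i : i \in orthogonal_walls -> side z' i = side z i.
    move=> Li; have := Li; rewrite inE => /and3P[Ji v0 _].
    have := dz i; rewrite /lexicographic v0 => -[_ ->].
    by have := dw i; rewrite /lexicographic (negbTE (rz _ Li)) => -[].
  exists z'; split=> //; apply: rt_trans ry' _.
  have rL t : regular J t -> regular orthogonal_walls t by move=> rt i /LJ; apply: rt.
  have sepL i : i \in orthogonal_walls -> separates y' z' i = separates y z i.
    by move=> Li; rewrite /separates sy' // sz'.
  apply: (reach_crossing sJ stable_orthogonal orthogonal_sub gy' rz' cy' cz').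
  - move=> i Li; rewrite sepL // => si; case: (gyz i Li si) => h;
      [constructor 1|constructor 2|by constructor 3].
      by rewrite /separates sy' // (stable_same stable_orthogonal.1 (rL _ gy') ry).
    by rewrite /separates sy' // (stable_same stable_orthogonal.2 (rL _ gy') ry).
  - by move=> i j Li Lj; rewrite !sepL //; apply: oyz.
  move=> i Ji NLi si; apply: free_orthogonal => //; apply/eqP; apply: contraT => v0.
  by move: si; rewrite /separates (cy' _ Ji v0) (cz' _ Ji v0) eqxx.
have [|y [ry gy hy]] := reach_push (v := v) (u := u) sJ gx' cx'.
  move=> i Ji v0 u0 su; apply: free_orthogonal => //; apply: contra su => Li.
  by rewrite sx' // cu.
by exists y; split=> //; apply: rt_trans rx' ry.
Qed.

End Eigen.

(** * The span of the normals and the Rayleigh quotient *)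

(** Membership in the span of the normals, stated as double orthogonality. *)
Definition spanned (J : {set I}) u :=
  forall w, (forall i, i \in J -> b w (e i) = 0) -> b u w = 0.

(** Gram-Schmidt: each new normal contributes its component [na] orthogonal to the normals already
    treated, or nothing when this component vanishes. *)
Lemma spanned_projection (J : {set I}) x :
  exists2 u, spanned J u & forall i, i \in J -> b u (e i) = b x (e i).
Proof.
suff [u Uu hu] : exists2 u,
    (forall w, (forall i, i \in enum J -> b w (e i) = 0) -> b u w = 0) &
    forall i, i \in enum J -> b u (e i) = b x (e i).
  exists u => [w hw|i Ji]; last by apply: hu; rewrite mem_enum.
  by apply: Uu => i; rewrite mem_enum; apply: hw.
elim: (enum J) x => [|a s IH] x; first (exists 0; first by move=> w _; rewrite b0l);
  first by [].
have [ua Ua ha] := IH (e a); have [ux Ux hx] := IH x.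
have [na naE] : exists na, na = e a - ua by exists (e a - ua).
have [nx nxE] : exists nx, nx = x - ux by exists (x - ux).
have nas i : i \in s -> b na (e i) = 0 by move=> si; rewrite naE !bE ha // subrr.
have nxs i : i \in s -> b nx (e i) = 0 by move=> si; rewrite nxE !bE hx // subrr.
have xE i : b x (e i) = b ux (e i) + b nx (e i) by rewrite nxE !bE; ring.
have uaE w : b (e a) w = b ua w + b na w by rewrite naE !bE; ring.
have [na0|naN0] := eqVneq na 0.
  exists ux => [w hw|i]; first by apply: Ux => i si; apply: hw; rewrite inE si orbT.
  rewrite inE => /predU1P[->|/hx //].
  by rewrite xE [b nx _]bC uaE na0 b0l // Ua // !addr0.
pose c := b nx na / b na na; exists (ux + c *: na) => [w hw|i].
  have hs i : i \in s -> b w (e i) = 0 by move=> si; apply: hw; rewrite inE si orbT.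
  rewrite !bE Ux // naE !bE Ua // [b (e a) _]bC hw ?mem_head //.
  by rewrite oppr0 addr0 mulr0 addr0.
rewrite inE => /predU1P[->|si]; last by rewrite !bE nas // mulr0 addr0 hx.
have bna := bpos naN0.
rewrite xE !bE; congr (_ + _); rewrite ![b _ (e a)]bC !uaE !Ua //.
by rewrite !add0r /c [b na nx]bC mulrVK // unitfE gt_eqF.
Qed.

Lemma spannedD J c u v : spanned J u -> spanned J v -> spanned J (c *: u + v).
Proof. by move=> Uu Uv w hw; rewrite !bE Uu // Uv // mulr0 addr0. Qed.

Lemma spanned0 J u : spanned J u -> (forall i, i \in J -> b u (e i) = 0) -> u = 0.
Proof. by move=> Uu hu; apply: b_eq0; apply: Uu. Qed.

Lemma giD x y : gi (x + y) = gi x + gi y.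
Proof. by apply: (can_inj gK); rewrite gD !giK. Qed.
Lemma giZ a x : gi (a *: x) = a *: gi x.
Proof. by apply: (can_inj gK); rewrite gZ !giK. Qed.
Lemma bgl x y : b (g x) y = b x (gi y).
Proof. by rewrite -[y in LHS]giK bg. Qed.
Lemma bgil x y : b (gi x) y = b x (g y).
Proof. by rewrite -[x in RHS]giK bg. Qed.
(* locked to prevent rewriting with bilinearity from expanding sym x *)
Definition sym := locked (fun x => g x + gi x).
Lemma symE x : sym x = g x + gi x. Proof. by rewrite /sym -lock. Qed.
Lemma b_sym x y : b (sym x) y = b x (sym y).
Proof. by rewrite !symE !bE bgl bgil addrC. Qed.
Lemma symD a x y : sym (a *: x + y) = a *: sym x + sym y.
Proof. by rewrite !symE gD giD gZ giZ scalerDr addrACA. Qed.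
Lemma sym_g x : sym (g x) = g (sym x).
Proof. by rewrite !symE gK gD giK. Qed.
Lemma sym_gi x : sym (gi x) = gi (sym x).
Proof. by rewrite !symE giK giD gK. Qed.

Definition eigen (k : R) z := sym z = k *: z.

Lemma eigenD k a x y : eigen k x -> eigen k y -> eigen k (a *: x + y).
Proof.
by rewrite /eigen symD => -> ->; rewrite scalerDr !scalerA mulrC.
Qed.
Lemma eigen_g k x : eigen k x -> eigen k (g x).
Proof. by rewrite /eigen sym_g => ->; rewrite gZ. Qed.
Lemma eigen_gi k x : eigen k x -> eigen k (gi x).
Proof. by rewrite /eigen sym_gi => ->; rewrite giZ. Qed.
Lemma eigen0 k : eigen k 0.
Proof. by rewrite /eigen -(scale0r 0) -[X in sym X]addr0 symD !scale0r add0r scaler0 symE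
  -{1}(gK 0) giK -(scale0r 0) gZ giZ !scale0r addr0. Qed.

Lemma spanned_sym J u : stable J -> spanned J u -> spanned J (sym u).
Proof.
move=> [side sgi] Uu w hw; rewrite b_sym symE; apply: Uu => i Ji; rewrite bDl.
have [j [c [Jj _ ->]]] := side i Ji; have [j' [c' [Jj' _ ->]]] := sgi i Ji.
by rewrite !hw // !mulr0 addr0.
Qed.

(** The projection u and z agree on all normals, and by stability so do [sym u] and [sym z]. Hence
    sym u - k u lies in the span and is orthogonal to it. *)
Lemma eigen_spanned J k z : stable J -> eigen k z ->
  exists u, [/\ spanned J u, eigen k u & forall i, i \in J -> b u (e i) = b z (e i)].
Proof.
move=> sJ Ez; have [u Uu hu] := spanned_projection J z; exists u; split=> //.
have UM : spanned J (- k *: u + sym u) by apply: spannedD => //; apply: spanned_sym.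
suff d0 : - k *: u + sym u = 0.
  by apply/eqP; rewrite -subr_eq0 addrC -scaleNr d0.
apply: (spanned0 UM) => i Ji.
have [j [c [Jj _ Ej]]] := sJ.1 i Ji; have [j' [c' [Jj' _ Ej']]] := sJ.2 i Ji.
have : b (sym z) (e i) = b (k *: z) (e i) by rewrite Ez.
by rewrite !symE !bE !Ej !Ej' !hu // => ->; rewrite mulNr addNr.
Qed.

(* w is the gradient of the Rayleigh quotient at v, up to a positive factor. *)
Lemma rayleigh_critical v w l : v != 0 -> sym v = l *: v + w -> b w v = 0 ->
  (exists2 h0, 0 < h0 & forall h, 0 < h <= h0 ->
     b (sym (v + h *: w)) (v + h *: w) * b v v <=
     b (sym v) v * b (v + h *: w) (v + h *: w)) -> w = 0.
Proof.
move=> vN0 Mv wv [h0 h0p hh]; apply/eqP; apply: contraT => wN0.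
have bv := bpos vN0; have bw := bpos wN0.
set d := b (sym w) w - l * b w w.
have ad : 0 < `|d| + 1 by rewrite ltr_wpDl.
(* With W = b w w and N = b v v, maximality reads h N (2 W + h d) <= 0; this h keeps h |d| below
   W. *)
pose h := Num.min h0 (b w w / (`|d| + 1)).
have hp : 0 < h by rewrite /h lt_min h0p divr_gt0.
have := hh h; rewrite hp /h ge_min lexx => /(_ isT); rewrite -/h.
rewrite [v + _]addrC symD Mv !bE [b v w]bC wv [b (sym w) v]b_sym Mv !bE [b w v]bC [b v
  w]bC wv.
have hd : h * (`|d| + 1) <= b w w by rewrite -ler_pdivlMr // /h ge_min lexx orbT.
have dle : - `|d| <= d by rewrite lerNl ler_normr lexx orbT.
have -> : b (sym w) w = d + l * b w w by rewrite /d subrK.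
set W := b w w in bw hd *; set N := b v v in bv *; set a := `|d| in ad hd dle.
have h2 : 0 < h * N by rewrite mulr_gt0.
move=> H; have : (h * N) * (2 * W + h * d) <= 0.
  by rewrite -subr_ge0; move: H; rewrite -subr_ge0 => H; apply: le_trans H _;
    rewrite le_eqVlt; apply/orP; left; apply/eqP; ring.
rewrite pmulr_rle0 //; apply: contraTT => _; rewrite -ltNge; nra.
Qed.

(** [C] is a set of sign patterns, that is, of chambers, and v is in the closure of one of them. In
    the span of the normals a nonzero vector avoids some wall, which makes the inductions on walls
    decrease. *)
Definition cone (J : {set I}) (C : {set I} -> Prop) v :=
  spanned J v /\
  exists2 s : {set I}, C s & forall i, i \in J -> b v (e i) != 0 -> side v i = (i \in s).

(* This holds by compactness, see max_cone_rV. *)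
Hypothesis max_cone : forall J C, (exists2 v, v != 0 & cone J C v) ->
  exists v, [/\ v != 0, cone J C v &
    forall u, cone J C u -> b (sym u) u * b v v <= b (sym v) v * b u u].

(** A maximum v over the closures of the reachable chambers is an eigenvector, since otherwise one
    could follow the gradient. Induction on the walls orthogonal to v and g v gives a direction in
    E; if the eigenvalue of v were below k, moving that way would increase the quotient. So v is in
    E, and a small displacement inside E makes it regular. *)
Lemma reach_eigen J k x : stable J ->
  (forall u, spanned J u -> b (sym u) u <= k * b u u) -> regular J x ->
  exists y z, [/\ reach J x y, eigen k z, adherent J z y &
    forall i, i \in J -> b z (e i) = 0 -> forall z', eigen k z' -> b z' (e i) = 0].
Proof.
have [m] := ubnP #|J|; elim: m J x => // m IH J x; rewrite ltnS => lem sJ HR rx.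
have [alli|] := pselect (forall i, i \in J -> forall z', eigen k z' -> b z' (e i) = 0).
  exists x, 0; split=> //; [exact: rt_refl|exact: eigen0| |by move=> i /alli].
  by move=> i _; rewrite b0l // eqxx.
move=> /existsNP[i0] /not_implyP[Ji0] /existsNP[z0] /not_implyP[Ez0 /eqP z0i].
have [zu [Uzu Ezu hzu]] := eigen_spanned sJ Ez0.
have zuN0 : zu != 0 by apply: contraNneq z0i => z00; rewrite -hzu // z00 b0l.
pose C (s : {set I}) := exists2 y, reach J x y & s = [set i | side y i].
have coneE y v : reach J x y -> spanned J v -> adherent J v y -> cone J C v.
  move=> ry Uv cv; split=> //; exists [set i | side y i]; first by exists y.
  by move=> i Ji vi; rewrite inE cv.
have [|v [vN0 [Uv [s [y0 xy0 ->] hs]] vmax]] := max_cone (J := J) (C := C).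
  have [u Uu hu] := spanned_projection J x; exists u.
    by apply: contraNneq (rx _ Ji0) => u0; rewrite -hu // u0 b0l.
  apply: (coneE x) => //; first exact: rt_refl.
  by move=> i Ji _; rewrite /side hu.
have cy0 : adherent J v y0 by move=> i Ji vi; rewrite (hs i Ji vi) inE.
have ry0 := reach_regular xy0 rx; have bv := bpos vN0.
pose l := b (sym v) v / b v v; pose w := - l *: v + sym v.
have lE : b (sym v) v = l * b v v by rewrite mulrVK // unitfE gt_eqF.
have wv : b w v = 0 by rewrite /w !bE lE mulNr addNr.
have Mw : sym v = l *: v + w by rewrite /w addrA -scalerDl subrr scale0r add0r.
have Uw : spanned J w by apply: spannedD => //; apply: spanned_sym.
have w0 : w = 0.
  apply: (rayleigh_critical vN0 Mw wv).
  have [|y1 [y01 _ [h0 h0p hh]]] := reach_push (u := w) sJ ry0 cy0.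
    (* On a wall through v the gradient has the coordinate of g v + g^-1 v, so g v or g^-1 v lies on
       the side of [w]. *)
    move=> i Ji vi wi _; have gE : b (g v) (e i) + b (gi v) (e i) = b w (e i).
      by rewrite -bDl -symE Mw !bE vi mulr0 add0r.
    have [/andP[h /eqP sgw]|] := boolP ((b (g v) (e i) != 0) && (side (g v) i == side w i)).
      by left; split=> //; rewrite h.
    rewrite negb_and negbK => h; right; move: wi h; rewrite /side -gE.
    set p := b (g v) _; set q := b (gi v) _ => pq.
    case/orP=> [/eqP p0|ps]; first by move: pq; rewrite p0 add0r.
    case: (ltrgt0P q) => hq; split=> //; case: (ltrgt0P p) ps => hp;
      case: (ltrgt0P (p + q)) => h //; lra.
  exists h0 => // h hlt; apply: vmax; apply: (coneE y1); first exact: rt_trans xy0 y01.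
    by rewrite addrC; apply: spannedD.
  by have [] := hh h hlt.
have Mv : g v + gi v = l *: v by rewrite -symE Mw w0 addr0.
have KJ : orthogonal_walls J v \proper J.
  apply/fintype.properP; split; first exact: orthogonal_sub.
  have [i Ji vi] : exists2 i, i \in J & b v (e i) != 0.
    apply: contrapT => h; move/eqP: vN0; apply; apply: (spanned0 Uv) => i Ji.
    by apply/eqP; apply: contraT => vi; case: h; exists i.
  by exists i => //; rewrite inE (negbTE vi) andbF.
have sK := stable_orthogonal sJ Mv.
have KJs := fintype.subsetP (fintype.proper_sub KJ).
have [||yk [z [ryk Ez cz regz]]] := IH _ y0 (leq_trans (proper_card KJ) lem) sK.
- by move=> u Uu; apply: HR => w' hw'; apply: Uu => i /KJs; apply: hw'.
- by move=> i /KJs; apply: ry0.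
have [u2 [Uu2 Eu2 u2N0 cu2 regu2]] : exists u2, [/\ spanned J u2, eigen k u2, u2 != 0,
    adherent (orthogonal_walls J v) u2 yk & forall i, i \in orthogonal_walls J v ->
      b u2 (e i) = 0 ->
    forall z', eigen k z' -> b z' (e i) = 0].
  (* If the projection vanishes, all orthogonal walls contain E and the nonzero eigenvector [zu]
     does as well. *)
  have [u [Uu Eu hu]] := eigen_spanned sJ Ez; have [u0|uN0] := eqVneq u 0.
    have zJ i : i \in J -> b z (e i) = 0 by move=> Ji; rewrite -hu // u0 b0l.
    exists zu; split=> //; move=> i Li; last by move=> _; apply: regz => //; apply/zJ/KJs.
    by rewrite (regz i Li (zJ _ (KJs _ Li)) _ Ezu) eqxx.
  exists u; split=> // i Li; first by rewrite /side !hu ?KJs //; apply: cz.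
  by rewrite hu ?KJs //; apply: regz.
have [lk|lNk] := eqVneq l k; last first.
  have [y [y0y _ [h0 h0p hh]]] :=
    reach_advance sJ Mv ry0 cy0 ryk cu2.
  have h00 : 0 < h0 <= h0 by rewrite h0p lexx.
  have : cone J C (v + h0 *: u2).
    apply: (coneE y); [exact: rt_trans xy0 y0y|by rewrite addrC; apply: spannedD|].
    by have [] := hh h0 h00.
  have u2v : b u2 v = 0.
    have : k * b u2 v = l * b u2 v by rewrite -bZl -Eu2 b_sym symE Mv !bE.
    by move/eqP; rewrite -subr_eq0 -mulrBl mulf_eq0 subr_eq0 eq_sym (negbTE lNk) => /eqP.
  move/vmax; rewrite [v + _]addrC symD Eu2 [sym v]symE Mv !bE [b v u2]bC u2v.
  have bu := bpos u2N0; have lk : l < k.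
    by rewrite lt_neqAle lNk -(ler_pM2r bv) -lE HR.
  have : 0 < h0 ^+ 2 * b u2 u2 * b v v by rewrite !mulr_gt0 ?exprn_gt0.
  set A := b u2 u2; set B := b v v => AB hle.
  have : (k - l) * (h0 ^+ 2 * A * B) <= 0.
    rewrite -subr_ge0; move: hle; rewrite -subr_ge0 => hle.
    by apply: le_trans hle _; rewrite le_eqVlt; apply/orP; left; apply/eqP; ring.
  by rewrite leNgt mulr_gt0 // subr_gt0.
rewrite lk in Mv; have Ev : eigen k v by rewrite /eigen symE.
(* Adding a small multiple of g v changes nothing on the orthogonal walls, and moves [u2] off the
   other walls that contain v. *)
have [h1 h1p hh1] := small_lexicographic u2 (g v).
pose u3 := u2 + h1 *: g v; have l3 : forall i, lexicographic u2 (g v) u3 i.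
  by apply: hh1; rewrite h1p lexx.
have u3K i : i \in orthogonal_walls J v -> b u3 (e i) = b u2 (e i).
  by rewrite inE => /and3P[_ _ /eqP gv0]; rewrite /u3 !bE gv0 mulr0 addr0.
have cu3 : adherent (orthogonal_walls J v) u3 yk.
  by move=> i Li; rewrite /side u3K //; apply: cu2.
have [y [y0y _ [h0 h0p hh]]] :=
    reach_advance sJ Mv ry0 cy0 ryk cu3.
have h00 : 0 < h0 <= h0 by rewrite h0p lexx.
exists y, (v + h0 *: u3); split.
- exact: rt_trans xy0 y0y.
- rewrite addrC; apply: eigenD => //; rewrite /u3 addrC; apply: eigenD => //.
  exact: eigen_g.
- by have [] := hh h0 h00.
move=> i Ji vi; have [_ /(_ i Ji vi)[v0 u30]] := hh h0 h00.
have [Li|NLi] := boolP (i \in orthogonal_walls J v).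
  by apply: regu2 => //; rewrite -u3K.
have gv0 : b (g v) (e i) != 0 by move: NLi; rewrite inE Ji v0 eqxx.
have := l3 i; rewrite /lexicographic u30 eqxx; case: eqP => _ [].
  by rewrite (negbTE gv0).
by [].
Qed.

(* h x is on a geodesic from x to h y *)
Definition geodesic (h : V -> V) (J : {set I}) x y :=
  forall i, i \in J -> ~~ (separates x (h x) i && separates (h x) (h y) i).
(** In each alternative the first half gives an additivity of lengths; comparison with the second
    half shows that the two conjugates have equal length. *)
Definition strong_link (J : {set I}) x y :=
  (geodesic g J x y /\ geodesic gi J y x) \/ (geodesic gi J x y /\ geodesic g J y x).
(** As g maps the crossed wall to itself, both chambers give the same conjugate, see
    [parallel_fix]. *)
Definition fixed_link (J : {set I}) x y :=
  single_wall J x y /\ forall i, i \in J -> separates x y i -> parallel (g (e i)) (e i).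
Definition link (J : {set I}) x y :=
  [/\ regular J x, regular J y & strong_link J x y \/ fixed_link J x y].
Definition linked J := clos_refl_trans V (link J).

Lemma same_strong_link J x y : stable J -> regular J x -> regular J y ->
  (forall i, i \in J -> side x i = side y i) -> strong_link J x y.
Proof.
move=> [sJ sJi] rx ry hs.
left; split=> i Ji; rewrite negb_and /separates; apply/orP; right.
  by rewrite (stable_same sJ rx ry hs Ji) eqxx.
by rewrite (stable_same sJi rx ry hs Ji) eqxx.
Qed.

(** * Chambers next to regular points of the eigenspace E *)

Section Shift.
Variables (J : {set I}) (k : R).
Hypothesis sJ : stable J.
Hypothesis k_gt : - 2 < k.
Hypothesis k_le : k <= 2.

(* The walls that contain the eigenspace E of k, and the other ones. *)
Definition orthE : {set I} := [set i in J | `[< forall z, eigen k z -> b z (e i) = 0 >]].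
Definition transE : {set I} := J :\: orthE.

Lemma orthE_sub : orthE \subset J.
Proof. by apply/fintype.subsetP=> i; rewrite inE => /andP[]. Qed.

Lemma orthE_eigen i z : i \in orthE -> eigen k z -> b z (e i) = 0.
Proof. by rewrite inE => /andP[_ /asboolP]; apply. Qed.

Lemma transE_sub i : i \in transE -> i \in J. Proof. by rewrite inE => /andP[]. Qed.

Lemma in_transE i : i \in J -> i \notin orthE -> i \in transE.
Proof. by move=> Ji Ni; rewrite finset.in_setD Ni. Qed.

Lemma stable_orthE_transE h hi : stable_by h J -> cancel hi h ->
  (forall z, eigen k z -> eigen k (h z)) -> (forall z, eigen k z -> eigen k (hi z)) ->
  stable_by h orthE /\ stable_by h transE.
Proof.
move=> sh hK eh ehi.
have key i j c : c != 0 -> i \in J -> j \in J ->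
    (forall x, b (h x) (e i) = c * b x (e j)) -> (i \in orthE) = (j \in orthE).
  move=> c0 Ji Jj E; rewrite !inE Ji Jj /=; apply/asboolP/asboolP => H z Ez.
    have /eqP := E z; rewrite H; last exact: eh.
    by rewrite eq_sym mulf_eq0 (negbTE c0) => /eqP.
  by rewrite -(hK z) E H ?mulr0 //; apply: ehi.
split=> i; last first.
  rewrite inE => /andP[Ni Ji]; have [j [c [Jj c0 E]]] := sh i Ji.
  by exists j, c; split=> //; rewrite inE Jj -(key i j c) // Ni.
move=> Ei; have Ji := fintype.subsetP orthE_sub _ Ei.
by have [j [c [Jj c0 E]]] := sh i Ji; exists j, c; split=> //; rewrite -(key i j c).
Qed.

Lemma stable_g : stable_by g orthE /\ stable_by g transE.
Proof.
apply: (stable_orthE_transE sJ.1 giK) => z; [exact: eigen_g|exact: eigen_gi].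
Qed.
Lemma stable_gi : stable_by gi orthE /\ stable_by gi transE.
Proof.
apply: (stable_orthE_transE sJ.2 gK) => z; [exact: eigen_gi|exact: eigen_g].
Qed.
Lemma stable_orthE : stable orthE.
Proof. by split; [case: stable_g | case: stable_gi]. Qed.

(** For z regular in E, this describes the chamber of the infinitely near point z + 0+ a. *)
Definition matches z a y :=
  [/\ regular J y, forall i, i \in transE ->
    side y i = side z i & forall i, i \in orthE -> side y i = side a i].

Lemma regular_transE x : regular J x -> regular transE x.
Proof. by move=> rx i /transE_sub; apply: rx. Qed.
Lemma regular_orthE x : regular J x -> regular orthE x.
Proof. by move=> rx i /(fintype.subsetP orthE_sub); apply: rx. Qed.

Lemma ex_match z a : eigen k z -> regular transE z -> regular orthE a ->
  exists y, matches z a y.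
Proof.
move=> Ez rz ra; have [y ly] := ex_lexicographic z a; exists y.
have yD i : i \in transE -> b y (e i) != 0 /\ side y i = side z i.
  by move=> Di; have := ly i; rewrite /lexicographic (negbTE (rz i Di)).
have yE i : i \in orthE -> b y (e i) != 0 /\ side y i = side a i.
  by move=> Ei; have := ly i; rewrite /lexicographic orthE_eigen // eqxx => -[-> ->];
    rewrite ra.
split=> [i Ji|i Di|i Ei]; [|by have [] := yD i Di|by have [] := yE i Ei].
have [Ei|Ni] := boolP (i \in orthE); first by have [] := yE i Ei.
by have [] := yD i (in_transE Ji Ni).
Qed.

Lemma match_geodesic h z z1 y y1 a a1 : stable_by h transE -> stable_by h orthE ->
  matches z a y -> matches z1 a1 y1 -> regular transE z -> regular transE z1 ->
  geodesic h transE z z1 -> geodesic h orthE y y1 -> geodesic h J y y1.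
Proof.
move=> sD sE [ry yz ya] [ry1 yz1 ya1] rz rz1 aD aE i Ji.
have [/aE //|Ni] := boolP (i \in orthE); have Di := in_transE Ji Ni.
rewrite /separates yz // (stable_same sD (regular_transE ry) rz yz Di).
by rewrite (stable_same sD (regular_transE ry1) rz1 yz1 Di); apply: aD.
Qed.

Lemma same_geodesic h K x y : stable_by h K -> regular K x -> regular K y ->
  (forall i, i \in K -> side x i = side y i) -> geodesic h K x y.
Proof.
by move=> sK rx ry hs i Ki; rewrite /separates (stable_same sK rx ry hs Ki) eqxx andbF.
Qed.

(* v is the point of the segment from z to z1 on their common wall. If g v is  *)
(* not on this wall, then g v or g^-1 v is on the side of z, which decides     *)
(* between the two forms of strong links. Otherwise the wall is g-stable and   *)
(* g acts by 1 or -1 on its normal in E; hence k = 2, and g is trivial on E.   *)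
Lemma strong_shift z z1 : eigen k z -> eigen k z1 -> regular transE z ->
  regular transE z1 ->
  (exists2 i, i \in transE & separates z z1 i) ->
  {in transE &, forall i j, separates z z1 i -> separates z z1 j ->
    ker_incl (eigen k) i j} ->
  strong_link transE z z1.
Proof.
move=> Ez Ez1 rz rz1 [i0 Di0 si0] kk.
have z0 := rz _ Di0; have z10 := rz1 _ Di0.
have [v [Ev vs vns]] : exists v, [/\ eigen k v,
    forall i, i \in transE -> separates z z1 i -> b v (e i) = 0 &
    forall i, i \in transE -> ~~ separates z z1 i -> b v (e i) != 0 /\ side v i = side z i].
  have sgn : b z (e i0) * b z1 (e i0) < 0.
    move: si0; rewrite /separates /side.
    case: (ltrgt0P (b z _)) z0 => // h _; case: (ltrgt0P (b z1 _)) z10 => // h1 _ _.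
      by rewrite pmulr_rlt0.
    by rewrite nmulr_rlt0.
  set p := b z (e i0) in sgn z0; set q := b z1 (e i0) in sgn z10.
  have q2 : 0 < q ^+ 2 by rewrite exprn_even_gt0.
  have p2 : 0 < p ^+ 2 by rewrite exprn_even_gt0.
  (* Weights with s p + t q = 0, positive because p q < 0. *)
  pose s := q ^+ 2 - p * q; pose t := p ^+ 2 - p * q.
  have s0 : 0 < s by rewrite /s; lra.
  have t0 : 0 < t by rewrite /t; lra.
  have Ev : eigen k (s *: z + (t *: z1 + 0)).
    by apply: eigenD => //; apply: eigenD => //; apply: eigen0.
  exists (s *: z + (t *: z1 + 0)); split=> // i Di si.
    by apply: (kk _ _ Di0 Di si0 si) => //; rewrite !bE -/p -/q /s /t; ring.
  rewrite !bE addr0; move: si; rewrite /separates /side negbK !bE addr0.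
  case: (ltrgt0P (b z (e i))) (rz i Di) => // hz _;
    case: (ltrgt0P (b z1 (e i))) (rz1 i Di) => // hz1 _ _.
    have H : 0 < s * b z (e i) + t * b z1 (e i) by rewrite addr_gt0 ?mulr_gt0.
    by rewrite H gt_eqF.
  have H : s * b z (e i) + t * b z1 (e i) < 0.
    by rewrite -oppr_gt0 opprD addr_gt0 // oppr_gt0 pmulr_rlt0.
  by rewrite lt_eqF //; split=> //; apply/negbTE; rewrite -leNgt ltW.
(* Two linear forms on E with the same kernel are proportional. *)
have propE i w : i \in transE -> separates z z1 i -> eigen k w ->
    b w (e i) * b z (e i0) = b w (e i0) * b z (e i).
  move=> Di si Ew; apply/eqP; rewrite -subr_eq0; apply/eqP.
  pose u := b z (e i0) *: w + ((- b w (e i0)) *: z + 0).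
  have Eu : eigen k u by apply: eigenD => //; apply: eigenD => //; apply: eigen0.
  have : b u (e i) = 0.
    by apply: (kk _ _ Di0 Di si0 si) => //; rewrite /u !bE; ring.
  by rewrite /u !bE => <-; ring.
(* Suppose that i separates y from h y, and h y from h y1. The wall j that h pulls back from i
   separates y from y1, so it has the trace of [i0], and [hi v] is on the side of y there. Thus v is
   on the side of h y for i; being off the common wall, it is also on the side of y, a
   contradiction. *)
have half h hi y y1 : stable_by h transE -> cancel hi h ->
    (forall w, eigen k w -> eigen k (h w)) -> (forall w, eigen k w -> eigen k (hi w)) ->
    eigen k y -> eigen k y1 -> regular transE y -> regular transE y1 ->
    (forall i, separates y y1 i = separates z z1 i) ->
    (forall i, i \in transE -> ~~ separates z z1 i -> side v i = side y i) ->
    (forall i w, i \in transE -> separates z z1 i -> eigen k w ->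
       b w (e i) * b y (e i0) = b w (e i0) * b y (e i)) ->
    b (hi v) (e i0) != 0 -> side (hi v) i0 = side y i0 -> geodesic h transE y y1.
  move=> sh hK eh ehi Ey Ey1 ry ry1 sepy vy pr hv0 hvs i Di; apply/negP => /andP[s1 s2].
  have [j [c [Dj c0 E]]] := sh i Di.
  have sj : separates z z1 j.
    move: s2; rewrite -sepy /separates /side !E !side_scale ?ry ?ry1 //.
    by case: (0 < c); case: (0 < b y _); case: (0 < b y1 _).
  have := pr j (hi v) Dj sj (ehi _ Ev); have yj := ry _ Dj; have y0 := ry _ Di0.
  have vi : b v (e i) = c * b (hi v) (e j) by rewrite -E hK.
  move=> pE; have hvj : b (hi v) (e j) != 0.
    by apply: contraTneq (mulf_neq0 hv0 yj) => h0; rewrite -pE h0 mul0r negbK.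
  have hvjs : (0 < b (hi v) (e j)) = (0 < b y (e j)).
    have : (0 < b (hi v) (e j) * b y (e i0)) = (0 < b (hi v) (e i0) * b y (e j)) by
      rewrite pE.
    rewrite !side_scale //; move: hvs; rewrite /side => ->.
    by case: (0 < b (hi v) _); case: (0 < b y (e i0)); case: (0 < b y (e j)).
  have vi0 : b v (e i) != 0 by rewrite vi mulf_neq0.
  have ns : ~~ separates z z1 i by apply: contra vi0 => /(vs _ Di) ->.
  move: s1; rewrite /separates -(vy i Di ns) /side vi E !side_scale // hvjs.
  by rewrite eqxx.
have eg := eigen_g (k := k); have egi := eigen_gi (k := k).
have [gv0|gv0] := eqVneq (b (g v) (e i0)) 0.
  have [j [c [Dj c0 E]]] := stable_g.2 i0 Di0.
  have vj : b v (e j) = 0.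
    by move: gv0; rewrite E => /eqP; rewrite mulf_eq0 (negbTE c0) => /eqP.
  have sj : separates z z1 j.
    by apply: contraT => /(vns _ Dj)[]; rewrite vj eqxx.
  (* Composition with g multiplies the form of [i0] on E by d. Hence k d = d^2 + 1, and the bounds
     on k leave only d = 1 and k = 2. *)
  pose d := c * b z (e j) / b z (e i0).
  have dE w : eigen k w -> b (g w) (e i0) = d * b w (e i0).
    move=> Ew; rewrite E /d; have := propE j w Dj sj Ew.
    move=> H; have -> : b w (e j) = b w (e i0) * b z (e j) / b z (e i0).
      by rewrite -H mulfK.
    by ring.
  have kd : k * d = d ^+ 2 + 1.
    have h1 := dE _ (egi _ Ez); rewrite giK in h1.
    have : b (sym z) (e i0) = k * b z (e i0) by rewrite Ez bZl.
    rewrite symE bDl dE // => h2; apply: (mulIf z0).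
    by rewrite mulrAC -h2 mulrDl mulrDl mul1r [b (gi z) _ * d]mulrC -h1 mulrAC -expr2.
  have k2 : k = 2.
    have [d0|d0|d0] := ltrgt0P d; last by move: kd; rewrite d0; lra.
      have h : (d - 1) ^+ 2 = (k - 2) * d by rewrite mulrBl kd; ring.
      have d1 : d = 1.
        apply/eqP; rewrite -subr_eq0 -sqrf_eq0 eq_le sqr_ge0 h andbT.
        by rewrite mulr_le0_ge0 ?subr_le0 // ltW.
      by move: kd; rewrite d1; lra.
    have h : (d + 1) ^+ 2 = (k + 2) * d by rewrite mulrDl kd; ring.
    have := sqr_ge0 (d + 1); rewrite h pmulr_rge0; first by rewrite leNgt d0.
    by rewrite -ltrBlDr sub0r.
  have gfix w : eigen k w -> g w = w.
    move=> Ew; apply/eqP; rewrite -subr_eq0; apply/eqP/b_eq0.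
    have : b (sym w) w = k * b w w by rewrite Ew bZl.
    rewrite symE !bE bg [b (gi w) w]bgil [b w (g w)]bC k2 => h; lra.
  have gifix w : eigen k w -> gi w = w by move=> Ew; rewrite -{1}(gfix w Ew) gK.
  left; split=> i Di; rewrite ?gfix ?gifix // /separates eqxx //.
have giv : b (gi v) (e i0) = - b (g v) (e i0).
  apply/eqP; rewrite -addr_eq0 addrC -bDl -symE Ev bZl.
  by rewrite (vs _ Di0 si0) mulr0.
have giv0 : b (gi v) (e i0) != 0 by rewrite giv oppr_eq0.
have opp : side (gi v) i0 = ~~ side (g v) i0.
  by rewrite /side giv oppr_gt0; case: (ltrgt0P (b (g v) _)) gv0.
have sepC i : separates z1 z i = separates z z1 i by rewrite /separates eq_sym.
have vz1 i : i \in transE -> ~~ separates z z1 i -> side v i = side z1 i.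
  by move=> Di ns; have [_ ->] := vns i Di ns; move: ns; rewrite negbK => /eqP.
have vz i : i \in transE -> ~~ separates z z1 i ->
  side v i = side z i by move=> Di /(vns i Di)[].
have propE1 i w : i \in transE -> separates z z1 i -> eigen k w ->
    b w (e i) * b z1 (e i0) = b w (e i0) * b z1 (e i).
  move=> Di si Ew; apply: (mulIf z0).
  rewrite mulrAC propE // -[RHS]mulrA propE //; last by rewrite mulrA mulrAC.
have sz1 : side z1 i0 = ~~ side z i0.
  by move: si0; rewrite /separates; case: (side z i0); case: (side z1 i0).
have [sD sDi] := (stable_g.2, stable_gi.2).
have [s0|s0] := eqVneq (side (gi v) i0) (side z i0).
  left; split; first exact: (half g gi).
  by apply: (half gi g) => //; rewrite sz1 -s0 opp negbK.
have s1 : side (g v) i0 = side z i0.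
  by move: s0; rewrite opp; case: (side z i0); case: (side (g v) i0).
right; split; first exact: (half gi g).
by apply: (half g gi) => //; rewrite sz1 -s1 opp.
Qed.

(** Follow a gallery in E from z to z'. Each crossing is a strong link by [strong_shift]; for the
    walls containing E the position [a] stays the same. *)
Lemma linked_shift z z' a y y' : eigen k z -> eigen k z' -> regular transE z ->
  regular transE z' -> regular orthE a ->
  matches z a y -> matches z' a y' -> linked J y y'.
Proof.
move=> Ez Ez' rz rz' ra my my'.
suff : forall y, matches z a y -> linked J y y' by apply.
move: (z) Ez rz; apply: (@gallery_ind (eigen k) transE _ z'
    (fun z => forall y, matches z a y -> linked J y y')) => //.
- by move=> c u w; apply: eigenD.
- move=> {}z Ez rz ns {}y {my} [ry yz ya]; have [ry' yz' ya'] := my'.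
  apply: rt_step; split=> //; left; apply: same_strong_link => // i Ji.
  have [Ei|Ni] := boolP (i \in orthE); first by rewrite ya // ya'.
  have Di := in_transE Ji Ni; rewrite yz // yz' //; apply/eqP.
  by have := ns i Di; rewrite negbK.
move=> {}z z1 Ez rz Ez1 rz1 ne _ kk IH {}y {my} my.
have [y1 my1] := ex_match Ez1 rz1 ra.
apply: (rt_trans _ _ _ y1); last exact: IH.
have [ry yz ya] := my; have [ry1 yz1 ya1] := my1.
have sE i : i \in orthE -> side y i = side y1 i by move=> Ei; rewrite ya // ya1.
have sE' i : i \in orthE -> side y1 i = side y i by move=> Ei; rewrite sE.
have [[sEg sDg] [sEi sDi]] := (stable_g, stable_gi).
apply: rt_step; split=> //; left.
have [[h1 h2]|[h1 h2]] := strong_shift Ez Ez1 rz rz1 ne kk; [left|right].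
  split; [apply: (match_geodesic sDg sEg my my1)|apply: (match_geodesic sDi sEi my1 my)]
    => //;
  by apply: same_geodesic => //; apply: regular_orthE.
split; [apply: (match_geodesic sDi sEi my my1)|apply: (match_geodesic sDg sEg my1 my)] =>
  //;
by apply: same_geodesic => //; apply: regular_orthE.
Qed.

(** * Galleries among the walls containing E, next to a fixed point *)

Section Lift.
Variable z : V.
Hypotheses (Ez : eigen k z) (rz : regular transE z).

Lemma lift_separates a a' y y' : matches z a y -> matches z a' y' ->
  (forall i, i \in J -> separates y y' i -> i \in orthE) /\
  (forall i, i \in orthE -> separates y y' i = separates a a' i).
Proof.
move=> [ry yz ya] [ry' yz' ya']; split=> i.
  move=> Ji; apply: contraTT => Ni; have Di := in_transE Ji Ni.
  by rewrite /separates yz // yz' // eqxx.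
by move=> Ei; rewrite /separates ya // ya'.
Qed.

(** Only walls containing E are crossed, and whether they are crossable depends only on positions
    with respect to such walls, since their set is g-stable. *)
Lemma lift_reach a a' y : reach orthE a a' -> matches z a y ->
  exists2 y', matches z a' y' & reach J y y'.
Proof.
move=> /clos_rt_rtn1_iff + my.
elim=> [|u w [ru rw ouw guw] _ [y1 my1 ry1]]; first by exists y => //; apply: rt_refl.
have [y2 my2] := ex_match Ez rz rw; exists y2 => //.
apply: rt_trans ry1 _; apply: rt_step.
have [gy1 yz1 ya1] := my1; have [gy2 _ _] := my2.
have [sub sepE] := lift_separates my1 my2; split=> // [i j Ji Jj si sj|i Ji si].
  have Ei := sub i Ji si; have Ej := sub j Jj sj.
  by apply: ouw => //; rewrite -sepE.
have Ei := sub i Ji si; rewrite sepE // in si.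
have [sEg sEi] := stable_orthE.
case: (guw i Ei si) => h; [constructor 1|constructor 2|by constructor 3].
  by rewrite /separates ya1 // (stable_same sEg (regular_orthE gy1) ru ya1).
by rewrite /separates ya1 // (stable_same sEi (regular_orthE gy1) ru ya1).
Qed.

Lemma lift_linked a a' y y' : linked orthE a a' -> matches z a y -> matches z a' y' ->
  regular orthE a -> linked J y y'.
Proof.
move=> laa' my my' ra.
have [y1 my1 ly1] : exists2 y1, matches z a' y1 & linked J y y1.
  move: laa' => /clos_rt_rtn1_iff.
  elim=> [|u w [ru rw lk] _ [y1 my1 ly1]]; first by exists y => //; apply: rt_refl.
  have [y2 my2] := ex_match Ez rz rw; exists y2 => //.
  apply: rt_trans ly1 _; apply: rt_step.
  have [gy1 yz1 ya1] := my1; have [gy2 yz2 ya2] := my2.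
  have [sub sepE] := lift_separates my1 my2.
  have [[sEg sDg] [sEi sDi]] := (stable_g, stable_gi).
  have zz h : stable_by h transE -> geodesic h transE z z by move=> sh;
    apply: same_geodesic.
  have tr h p q yp yq : stable_by h orthE -> regular orthE p -> regular orthE q ->
      matches z p yp -> matches z q yq -> geodesic h orthE p q -> geodesic h orthE yp yq.
    move=> sh rp rq [gp _ sp] [gq _ sq] H i Ei.
    by rewrite /separates sp // (stable_same sh (regular_orthE gp) rp sp Ei)
      (stable_same sh (regular_orthE gq) rq sq Ei); apply: H.
  split=> //; case: lk => [[[h1 h2]|[h1 h2]]|[h1 h2]].
  - left; left; split; [apply: (match_geodesic sDg sEg my1 my2)|
      apply: (match_geodesic sDi sEi my2 my1)] => //; try exact: zz.
      exact: (tr _ u w).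
    exact: (tr _ w u).
  - left; right; split; [apply: (match_geodesic sDi sEi my1 my2)|
      apply: (match_geodesic sDg sEg my2 my1)] => //; try exact: zz.
      exact: (tr _ u w).
    exact: (tr _ w u).
  right; split=> [i j Ji Jj si sj|i Ji si].
    have Ei := sub i Ji si; have Ej := sub j Jj sj.
    by apply: h1 => //; rewrite -sepE.
  by have Ei := sub i Ji si; apply: h2; rewrite -?sepE.
apply: rt_trans ly1 _; apply: rt_step; have [g1 z1 a1] := my1; have [g2 z2 a2] := my'.
split=> //; left; apply: same_strong_link => // i Ji.
have [Ei|Ni] := boolP (i \in orthE); first by rewrite a1 // a2.
by rewrite z1 ?z2 //; apply: in_transE.
Qed.

End Lift.
End Shift.

(** If g preserves every wall, fixed links join all chambers. Otherwise both chambers are brought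
    next to E and the induction hypothesis is applied to the walls containing E. The results are
    compared through [u1], which has the region of one and the position of the other. *)
Theorem confluence J x x' : stable J -> regular J x -> regular J x' ->
  exists y y', [/\ reach J x y, reach J x' y' & linked J y y'].
Proof.
have [m] := ubnP #|J|; elim: m J x x' => // m IH J x x'; rewrite ltnS => lem sJ rx rx'.
have [allp|] := pselect (forall i, i \in J -> parallel (g (e i)) (e i)).
  exists x, x'; split; [exact: rt_refl|exact: rt_refl|].
  apply: (@gallery_ind (fun=> True) J _ x'
    (fun x => linked J x x')) => // {x rx}.
    move=> x _ rx ns; apply: rt_step; split=> //; left; apply: same_strong_link => // i Ji.
    by apply/eqP; have := ns i Ji; rewrite negbK.
  move=> x x1 _ rx _ rx1 _ _ kk lx1; apply: rt_trans lx1; apply: rt_step.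
  split=> //; right; split=> [i j Ji Jj si sj|i Ji _]; last exact: allp.
  by apply: ker_incl_parallel; apply: kk.
move=> /existsNP[i0] /not_implyP[Ji0 Np].
have Ue i : i \in J -> spanned J (e i) by move=> Ji w hw; rewrite bC hw.
have coneU v : spanned J v -> cone J (fun=> True) v.
  by move=> Uv; split=> //; exists [set i | side v i] => // i _ _; rewrite inE.
have [|v [vN0 [Uv _] vmax]] := max_cone (J := J) (C := fun=> True).
  by exists (e i0); [exact: eN0|apply: coneU; apply: Ue].
have bv := bpos vN0; pose k := b (sym v) v / b v v.
have kE : b (sym v) v = k * b v v by rewrite mulrVK // unitfE gt_eqF.
have HR u : spanned J u -> b (sym u) u <= k * b u u.
  by move=> Uu; rewrite -(ler_pM2r bv) mulrAC -kE; apply: vmax; apply: coneU.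
have Ev : eigen k v.
  pose w := - k *: v + sym v.
  have Mw : sym v = k *: v + w by rewrite /w addrA -scalerDl subrr scale0r add0r.
  have w0 : w = 0.
    apply: (rayleigh_critical vN0 Mw); first by rewrite /w !bE kE mulNr addNr.
    exists 1 => // h _; apply: vmax; apply: coneU; rewrite addrC; apply: spannedD => //.
    by apply: spannedD => //; apply: spanned_sym.
  by rewrite /eigen Mw w0 addr0.
have ggv u : b (sym u) u = 2 * b (g u) u.
  by rewrite symE !bE [b (gi u) u]bgil [b u (g u)]bC; ring.
have k_le : k <= 2.
  rewrite -(ler_pM2r bv) -kE ggv; have := b_ge0 (g v - v).
  by rewrite !bE bg [b v (g v)]bC; lra.
(* Otherwise g would send [e i0] to its opposite and preserve the wall [i0]. *)
have k_gt : - 2 < k.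
  rewrite ltNge; apply/negP => k2; apply: Np; exists (-1).
  have := HR _ (Ue _ Ji0); rewrite ggv; have bi := bpos (eN0 i0) => hi.
  have h1 : b (g (e i0) + e i0) (g (e i0) + e i0) <= 0.
    rewrite !bE bg [b (e i0) (g _)]bC; nra.
  have h2 : g (e i0) + e i0 = 0.
    by apply/b_eq0/eqP; rewrite eq_le h1 b_ge0.
  by apply/eqP; rewrite scaleN1r -addr_eq0 h2.
have EJ : (#|orthE J k| < m)%N.
  apply: leq_trans lem; apply: proper_card; apply/fintype.properP.
  split; first exact: orthE_sub.
  have [i Ji vi] : exists2 i, i \in J & b v (e i) != 0.
    apply: contrapT => h; move/eqP: vN0; apply; apply: (spanned0 Uv) => i Ji.
    by apply/eqP; apply: contraT => vi; case: h; exists i.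
  exists i => //; apply: contra vi => Ei; apply/eqP; exact: orthE_eigen Ei Ev.
have [y [z [xy Ez cz regz]]] := reach_eigen sJ HR rx.
have [y' [z' [xy' Ez' cz' regz']]] := reach_eigen sJ HR rx'.
have rD u : (forall i, i \in J -> b u (e i) = 0 -> forall w, eigen k w -> b w (e i) = 0) ->
    regular (transE J k) u.
  move=> hu i Di; have Ji := transE_sub Di; apply/eqP => ui.
  move: Di; rewrite finset.in_setD => /andP[/negP[]]; rewrite inE Ji; apply/asboolP;
    exact: (hu i).
have rz := rD _ regz; have rz' := rD _ regz'.
have ry := reach_regular xy rx; have ry' := reach_regular xy' rx'.
have my : matches J k z y y by split=> // i Di; exact: (cz _ (transE_sub Di) (rz _ Di)).
have my' : matches J k z' y' y'.
  by split=> // i Di; exact: (cz' _ (transE_sub Di) (rz' _ Di)).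
have [a [a' [ra ra' laa']]] :=
  IH _ _ _ EJ (stable_orthE k sJ) (regular_orthE ry) (regular_orthE ry').
have rJa := reach_regular ra (regular_orthE ry);
  have rJa' := reach_regular ra' (regular_orthE ry').
have [u mu yu] := lift_reach sJ Ez rz ra my.
have [u' mu' yu'] := lift_reach sJ Ez' rz' ra' my'.
have [u1 mu1] := ex_match Ez' rz' rJa.
exists u, u'; split; [exact: rt_trans xy yu|exact: rt_trans xy' yu'|].
apply: (rt_trans _ _ _ u1); first exact: (linked_shift sJ k_gt k_le Ez Ez' rz rz' rJa).
exact: (lift_linked sJ Ez' rz' laa').
Qed.

End Arrangement.

(** * Closed cones, where the maximum is attained *)

Section Closed.
Local Open Scope ring_scope.
Local Open Scope classical_set_scope.
Variables (R : realType) (n : nat) (b : 'rV[R]_n -> 'rV[R]_n -> R).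
Local Notation V := 'rV[R]_n.
Hypothesis bDl : forall x y z, b (x + y) z = b x z + b y z.
Hypothesis bZl : forall a x z, b (a *: x) z = a * b x z.
Hypothesis bC : forall x y, b x y = b y x.
Hypothesis bco : forall (v : V) i, (v 0 i) ^+ 2 <= b v v.
Variables (I : finType) (e : I -> V).
Variables (g gi : V -> V).
Hypothesis gZ : forall a x, g (a *: x) = a *: g x.
Hypothesis gD : forall x y, g (x + y) = g x + g y.
Hypothesis gK : cancel g gi.
Hypothesis giK : cancel gi g.

Lemma half_space_closed w : closed [set v | b v w = 0] /\ closed [set v | 0 <= b v w]
   /\ closed [set v | b v w <= 0].
Proof.
have /continuous_closedP cb : continuous (b^~ w).
  by apply: linear_form_continuous.
split; [|split].
- exact: (cb [set x : R | x = 0] (@closed_eq R 0)).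
- exact: (cb [set x : R | 0 <= x] (@closed_ge R 0)).
- exact: (cb [set x : R | x <= 0] (@closed_le R 0)).
Qed.

Lemma cone_closed J C : closed (cone b e J C).
Proof.
pose K (s : {set I}) (i : I) :=
  [set v : V | if i \in s then 0 <= b v (e i) else b v (e i) <= 0].
have -> : cone b e J C =
    (\bigcap_(w in [set w | forall i, i \in J -> b w (e i) = 0]) [set v | b v w = 0])
    `&` \bigcup_(s in C) \bigcap_(i in [set i | i \in J]) K s i.
  apply/seteqP; split=> v /= [Uv [s Cs hs]]; split=> //.
    exists s => // i /= Ji; rewrite /K /=; have := hs i Ji; rewrite /side.
    by case: ifP => _; case: (ltrgt0P (b v (e i))) => // _ /(_ isT).
  exists s => // i Ji; have := hs i Ji; rewrite /K /side /=.
  by case: ifP => _; case: (ltrgt0P (b v (e i))).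
apply: closedI.
  by apply: closed_bigI => w _; have [] := half_space_closed w.
apply: closed_bigcup; first exact: finite_finset.
move=> s _; apply: closed_bigI => i _; rewrite /K.
have [_ [h1 h2]] := half_space_closed (e i).
by case: (i \in s).
Qed.

Lemma max_cone_rV J C : (exists2 v, v != 0 & cone b e J C v) ->
  exists v, [/\ v != 0, cone b e J C v &
    forall u, cone b e J C u ->
      b (sym g gi u) u * b v v <= b (sym g gi v) v * b u u].
Proof.
move=> [v0 v0N0 cv0].
have MD' := symD gZ gD gK giK.
have bDr x y z : b z (x + y) = b z x + b z y by rewrite bC bDl !(bC z).
have bZr a x z : b z (a *: x) = a * b z x by rewrite bC bZl !(bC z).
have M0 : sym g gi 0 = 0.
  by apply: (addrI (sym g gi 0));
    rewrite addr0 -{1}(scale1r (sym g gi 0)) -MD' scale1r addr0.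
have [|||||||v [cv vN0 vmax]] := @max_rayleigh R n b (fun x y => b (sym g gi x) y)
  (cone b e J C) bDl bZl bC bco.
- by move=> x y z; rewrite -{1}(scale1r x) MD' bDl scale1r.
- by move=> a x z; rewrite -{1}(addr0 (a *: x)) MD' M0 addr0 bZl.
- by move=> x y z; rewrite bDr.
- by move=> a x z; rewrite bZr.
- exact: cone_closed.
- move=> a v a0 [Uv [s Cs hs]]; split.
    by move=> w hw; rewrite bZl Uv // mulr0.
  exists s => // i Ji; rewrite bZl mulf_eq0 negb_or => /andP[_ /(hs _ Ji)].
  by rewrite /side bZl pmulr_rgt0.
- by exists v0.
by exists v; split.
Qed.

End Closed.

(** * Lengths and alternating words *)

Section Length.
Local Open Scope group_scope.
Variables (W : finGroupType) (S : {set W}).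
Hypothesis genS : <<S>> = [set: W].
Hypothesis ordS : {in S, forall s, #[s] = 2}.
Local Notation len := (cox_length S).

Lemma len_mem w : w \in S ^+ len w. Proof. by have [] := cox_lengthP w genS. Qed.
Lemma len_min n w : w \in S ^+ n -> len w <= n.
Proof. by have [_] := cox_lengthP w genS; apply. Qed.

Lemma len1 : len 1 = 0.
Proof. by apply/eqP; rewrite -leqn0 len_min // expg0 set11. Qed.

Lemma len_eq0 w : len w = 0 -> w = 1.
Proof. by move=> w0; have := len_mem w; rewrite w0 expg0 => /set1P. Qed.

Lemma lenM x y : len (x * y) <= len x + len y.
Proof. by apply: len_min; rewrite expgD mem_mulg ?len_mem. Qed.

Lemma lenS s : s \in S -> len s <= 1.
Proof. by move=> Ss; apply: len_min; rewrite expg1. Qed.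

Lemma invS s : s \in S -> s^-1 = s.
Proof. by move=> Ss; apply/eqP; rewrite eq_invg_mul -expg2 -(ordS Ss) expg_order. Qed.

Lemma mulSS s : s \in S -> s * s = 1.
Proof. by move=> Ss; rewrite -{1}(invS Ss) mulVg. Qed.

Lemma mulKS s w : s \in S -> w * s * s = w.
Proof. by move=> Ss; rewrite -mulgA mulSS // mulg1. Qed.

Lemma mulSK s w : s \in S -> s * (s * w) = w.
Proof. by move=> Ss; rewrite mulgA mulSS // mul1g. Qed.

Lemma lenV w : len w^-1 = len w.
Proof.
have le v : len v^-1 <= len v.
  apply: len_min; have := len_mem v.
  move: (len v) => n; elim: n v => [|n IH] v; first by rewrite !expg0 => /set1P ->;
    rewrite invg1 set11.
  move=> Sv; rewrite expgSr; move: Sv; rewrite {1}expgS => /mulsgP[s y Ss Sy ->].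
  by rewrite invMg (invS Ss) mem_mulg // IH.
by apply/eqP; rewrite eqn_leq le -{1}[w]invgK le.
Qed.

Lemma lenMS w s : s \in S -> len (w * s) <= (len w).+1.
Proof. by move=> Ss; apply: leq_trans (lenM _ _) _; rewrite -addn1 leq_add2l lenS. Qed.

Lemma lenSM w s : s \in S -> len (s * w) <= (len w).+1.
Proof. by move=> Ss; rewrite -lenV invMg (invS Ss) -(lenV w) lenMS. Qed.

Lemma lenMS_ge w s : s \in S -> len w <= (len (w * s)).+1.
Proof. by move=> Ss; rewrite -{1}(mulKS w Ss) lenMS. Qed.

Lemma len_descent w : w != 1 -> exists2 s, s \in S & len (w * s) < len w.
Proof.
move=> wN1; have := len_mem w; case E: (len w) => [|n].
  by rewrite expg0 => /set1P w1; rewrite w1 eqxx in wN1.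
rewrite expgSr => /mulsgP[y s Sy Ss def_w]; exists s => //.
by rewrite def_w mulKS // ltnS len_min.
Qed.

Lemma len_aut (a : {perm W}) w : a \in Aut [set: W] -> {in S, forall s, a s \in S} ->
  len (a w) <= len w.
Proof.
move=> autA aS; apply: len_min; have := len_mem w.
have aM x y : a (x * y) = a x * a y.
  by have /morphicP := Aut_morphic autA; apply; rewrite inE.
move: (len w) => n; elim: n w => [|n IH] w.
  by rewrite !expg0 => /set1P ->; rewrite inE; apply/eqP/(mulgI (a 1)); rewrite -aM !mulg1.
by rewrite !expgS => /mulsgP[s y Ss Sy ->]; rewrite aM mem_mulg ?IH ?aS.
Qed.

Fixpoint alt (s t : W) k := if k is k'.+1 then alt t s k' * t else 1.

Lemma alt_headE s t k : alt s t k.+1 = (if odd k then s else t) * alt s t k.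
Proof.
elim: k s t => [|k IH] s t; first by rewrite /= mulg1 mul1g.
by rewrite [LHS]/= -/(alt t s k.+1) IH -mulgA /= if_neg.
Qed.

Lemma len_alt s t k : s \in S -> t \in S -> len (alt s t k) <= k.
Proof.
elim: k s t => [|k IH] s t Ss St; first by rewrite len1.
by apply: leq_trans (lenMS _ St) _; rewrite ltnS IH.
Qed.

Lemma alt_prefix s t j m : s \in S -> t \in S ->
  exists2 x, alt s t (j + m) = x * alt s t m & len x <= j.
Proof.
move=> Ss St; elim: j => [|j [x def_x lex]]; first by exists 1; rewrite ?mul1g ?len1.
rewrite addSn alt_headE def_x mulgA; exists ((if odd (j + m) then s else t) * x) => //.
by apply: leq_trans (lenSM _ _) _; [case: ifP | rewrite ltnS].
Qed.

Lemma alt_double s t k : alt s t k.*2 = (s * t) ^+ k.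
Proof. by elim: k => // k IH; rewrite doubleS /= IH expgSr mulgA. Qed.

Lemma alt_braid s t m : s \in S -> t \in S -> (s * t) ^+ m = 1 -> alt s t m = alt t s m.
Proof.
move=> Ss St; have tsE : t * s = (s * t)^-1 by rewrite invMg !invS.
rewrite -[m]odd_double_half; set k := m./2; case: (odd m) => /=.
  rewrite add1n /= !alt_double -addnn => h.
  apply: (mulgI ((s * t) ^+ k)); rewrite tsE expgVn mulKVg mulgA -expgD.
  have -> : (s * t) ^+ (k + k) = t * s.
    by apply: (mulgI (s * t)); rewrite -expgS h -mulgA (mulSK _ St) mulSS.
  by rewrite mulKS.
rewrite add0n !alt_double tsE -addnn expgD => /eqP; rewrite -eq_invg_mul => /eqP <-.
by rewrite expgVn.
Qed.

End Length.

(** * The geometric representation *)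

(** The infinite group to which the universal property of the presentation is applied. *)
Definition GLmx (R : realType) n := {A : 'M[R]_n | A \in unitmx}.
HB.instance Definition _ R n := Choice.on (GLmx R n).

Section GLGroup.
Local Open Scope ring_scope.
Variables (R : realType) (n : nat).
Local Notation G := (GLmx R n).

Definition GLone : G := exist (fun A : 'M[R]_n =>
  A \in unitmx) (1%:M : 'M[R]_n) (unitmx1 R n).
Lemma GLmul_proof (A B : G) : val A *m val B \in unitmx.
Proof. by rewrite unitmx_mul (valP A) (valP B). Qed.
Definition GLmul (A B : G) : G := exist (fun A : 'M[R]_n =>
  A \in unitmx) _ (GLmul_proof A B).
Lemma GLinv_proof (A : G) : invmx (val A) \in unitmx.
Proof. by rewrite unitmx_inv (valP A). Qed.
Definition GLinv (A : G) : G := exist (fun A : 'M[R]_n => A \in unitmx) _ (GLinv_proof A).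
Lemma GLmulA : associative GLmul.
Proof. by move=> A B C; apply: val_inj; rewrite /= mulmxA. Qed.
Lemma GLmul1 : left_id GLone GLmul.
Proof. by move=> A; apply: val_inj; rewrite /= mul1mx. Qed.
Lemma GLmulr1 : right_id GLone GLmul.
Proof. by move=> A; apply: val_inj; rewrite /= mulmx1. Qed.
Lemma GLmulV : left_inverse GLone GLinv GLmul.
Proof. by move=> A; apply: val_inj; rewrite /= mulVmx ?(valP A). Qed.
Lemma GLmulrV : right_inverse GLone GLinv GLmul.
Proof. by move=> A; apply: val_inj; rewrite /= mulmxV ?(valP A). Qed.
HB.instance Definition _ := isGroup.Build G GLmulA GLmul1 GLmulr1 GLmulV GLmulrV.
End GLGroup.

Section Rep.
Local Open Scope ring_scope.
Variables (R : realType) (W : finGroupType) (S : {set W}).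
Hypothesis coxW : coxeter_system S.
Local Notation n := #|W|.
Local Notation V := 'rV[R]_n.
Local Notation len := (cox_length S).

Local Notation mm s t := (#[s * t])%g.
Lemma cox_gen : (<<S>> = [set: W])%g. Proof. by case: coxW. Qed.
Lemma cox_ord : {in S, forall s, (#[s] = 2)%g}. Proof. by case: coxW. Qed.

(* The basis is indexed by all of W instead of S: this avoids a dependent type, *)
(* and the root positivity theorem only involves the vectors alpha s, s in S.   *)
Definition alpha (w : W) : V := delta_mx 0 (enum_rank w).
Definition angle (s w : W) : R := pi / (mm s w)%:R.
(** The Coxeter bilinear form, paired with [alpha s]. *)
Definition bform s (v : V) : R := - \sum_w v 0 (enum_rank w) * cos (angle s w).
Definition refl s v : V := v + (- (2 * bform s v)) *: alpha s.

Lemma bformD s u v : bform s (u + v) = bform s u + bform s v.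
Proof.
by rewrite /bform -opprD -big_split; congr (- _); apply: eq_bigr => w _; rewrite mxE mulrDl.
Qed.
Lemma bformZ s a v : bform s (a *: v) = a * bform s v.
Proof.
by rewrite /bform mulrN mulr_sumr; congr (- _); apply: eq_bigr => w _; rewrite mxE mulrA.
Qed.
Lemma bform_alpha s w : bform s (alpha w) = - cos (angle s w).
Proof.
rewrite /bform (bigD1 w) //= big1 ?addr0 => [|u uw]; last first.
  by rewrite mxE eqxx /= (inj_eq enum_rank_inj) (negbTE uw) mul0r.
by rewrite mxE !eqxx mul1r.
Qed.

Lemma reflD s u v : refl s (u + v) = refl s u + refl s v.
Proof. by rewrite /refl bformD mulrDr opprD scalerDl addrACA. Qed.
Lemma reflZ s a v : refl s (a *: v) = a *: refl s v.
Proof. by rewrite /refl bformZ scalerDr scalerA; congr (_ + GRing.scale _ _); ring. Qed.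

Lemma angleC s t : s \in S -> t \in S -> angle t s = angle s t.
Proof.
move=> Ss St; rewrite /angle -orderV invMg.
by rewrite (invS cox_ord Ss) (invS cox_ord St).
Qed.

Lemma bform_ss s : s \in S -> bform s (alpha s) = 1.
Proof.
move=> Ss; rewrite bform_alpha /angle (mulSS cox_ord Ss) order1 divr1 cospi.
by rewrite opprK.
Qed.

Lemma refl_ss s : s \in S -> refl s (alpha s) = - alpha s.
Proof.
move=> Ss; rewrite /refl bform_ss // mulr1 -[X in X + _]scale1r -scalerDl -[RHS]scaleN1r.
by congr (GRing.scale _ _); ring.
Qed.

Lemma reflK s : s \in S -> involutive (refl s).
Proof.
move=> Ss v; rewrite {1}/refl /refl bformD bformZ bform_ss //.
rewrite -addrA -scalerDl mulr1 [X in X *: _](_ : _ = 0) ?scale0r ?addr0 //; ring.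
Qed.

(* Sines and cosines enter through P x = sin (x + th) t + sin x s, on which the  *)
(* product of the reflections s and t acts as the translation x |-> x + 2 th.    *)
Lemma refl_sin s t (x : R) : s \in S -> t \in S ->
  refl s (sin (x + angle s t) *: alpha t + sin x *: alpha s) =
  sin (x + angle s t) *: alpha t + sin (x + angle s t *+ 2) *: alpha s.
Proof.
move=> Ss St; set th := angle s t.
rewrite reflD !reflZ refl_ss // /refl bform_alpha -/th scalerDr -addrA; congr (_ + _).
rewrite scalerA scalerN -[X in _ + X]scaleNr -scalerDl; congr (GRing.scale _ _).
rewrite mulr2n addrA [sin (x + th + th)]sinD.
have -> : sin x = sin (x + th - th) by rewrite addrK.
by rewrite sinB; ring.
Qed.

Lemma order_mul_gt1 s t : s \in S -> t \in S -> s != t -> (1 < (mm s t))%N.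
Proof.
move=> Ss St; apply: contraNltn; rewrite leq_eqVlt ltnS leqn0 order_eq1.
rewrite eqn0Ngt order_gt0 orbF -eq_invg_mul (invS cox_ord Ss).
by [].
Qed.

Lemma sin_angle s t k : s \in S -> t \in S ->
  (0 < k < (mm s t))%N -> 0 < sin (angle s t *+ k).
Proof.
move=> Ss St /andP[k0 km]; have m0 : (0 : R) < (mm s t)%:R by rewrite ltr0n order_gt0.
apply: sin_gt0_pi; rewrite /angle pmulrn_lgt0 // divr_gt0 ?pi_gt0 //=.
rewrite -(mulr_natr _ k) -mulrA gtr_pMr ?pi_gt0 // mulrC ltr_pdivrMr // mul1r.
by rewrite ltr_nat.
Qed.

(** On the plane of alpha s and alpha t the product turns by 2 theta, so its m-th power is a full
    turn. It fixes the vectors orthogonal to both for the Coxeter form, and these complement the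
    plane because sin theta is nonzero. *)
Lemma refl_order s t v : s \in S -> t \in S ->
  iter (mm s t) (fun v => refl t (refl s v)) v = v.
Proof.
move=> Ss St; have [->|st] := eqVneq s t.
  by rewrite (mulSS cox_ord St) order1 /= reflK.
set m := mm s t; set th := angle s t; pose f v := refl t (refl s v).
have fD u w : f (u + w) = f u + f w by rewrite /f !reflD.
have fZ a u : f (a *: u) = a *: f u by rewrite /f !reflZ.
have itD k u w : iter k f (u + w) = iter k f u + iter k f w.
  by elim: k => //= k ->; rewrite fD.
have itZ k a u : iter k f (a *: u) = a *: iter k f u.
  by elim: k => //= k ->; rewrite fZ.
have m1 : (1 < m)%N by apply: order_mul_gt1.
have s0 : sin th != 0.
  by rewrite gt_eqF // -[th]mulr1n; apply: sin_angle; rewrite ?m1.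
have m0 : (m%:R : R) != 0 by rewrite pnatr_eq0 -lt0n ltnW.
have thm : th *+ m = pi by rewrite -mulr_natr /th /angle -/m mulfVK.
pose P x := sin (x + th) *: alpha t + sin x *: alpha s.
have fP x : f (P x) = P (x + th *+ 2).
  rewrite /f /P refl_sin // -/th addrC mulr2n !addrA.
  have := @refl_sin t s (x + th) St Ss; rewrite (angleC Ss St) -/th mulr2n => ->.
  by rewrite [LHS]addrC !addrA.
have itP x : iter m f (P x) = P x.
  have -> : iter m f (P x) = P (x + th *+ 2 *+ m).
    elim: (m) => [|k IH]; first by rewrite mulr0n addr0.
    by rewrite iterS IH fP -addrA -mulrSr.
  rewrite -mulrnA mulnC mulrnA thm /P.
  have -> : x + pi *+ 2 + th = x + th + pi *+ 2 by rewrite addrAC.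
  by rewrite !sinD2pi.
have ita : iter m f (alpha t) = alpha t.
  have := itP 0; rewrite /P add0r sin0 scale0r addr0 itZ => /(scalerI s0).
  by [].
have itb : iter m f (alpha s) = alpha s.
  have := itP (- th); rewrite /P addNr sin0 scale0r add0r itZ sinN => /scalerI; apply.
  by rewrite oppr_eq0.
pose p := bform s v; pose q := bform t v; pose c := cos th.
(* The solution of x - c y = p, y - c x = q, whose determinant is sin^2 theta. *)
pose x := (p + c * q) / sin th ^+ 2; pose y := (q + c * p) / sin th ^+ 2.
pose v0 := v + ((- x) *: alpha s + (- y) *: alpha t).
have s2 : sin th ^+ 2 != 0 by rewrite expf_neq0.
have bts : bform t (alpha s) = - c by rewrite bform_alpha (angleC Ss St).
have bst : bform s (alpha t) = - c by rewrite bform_alpha.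
have xs : x * sin th ^+ 2 = p + c * q by rewrite mulfVK.
have ys : y * sin th ^+ 2 = q + c * p by rewrite mulfVK.
have c2 := sin2cos2 th.
have v0s : bform s v0 = 0.
  rewrite !bformD !bformZ bform_ss // bst -/p; apply: (mulIf s2).
  rewrite mul0r [LHS](_ : _ = p * sin th ^+ 2 - x * sin th ^+ 2 + c * (y * sin th ^+ 2)).
    by rewrite xs ys c2 -/c; ring.
  ring.
have v0t : bform t v0 = 0.
  rewrite !bformD !bformZ bform_ss // bts -/q; apply: (mulIf s2).
  rewrite mul0r [LHS](_ : _ = q * sin th ^+ 2 - y * sin th ^+ 2 + c * (x * sin th ^+ 2)).
    by rewrite xs ys c2 -/c; ring.
  ring.
have f0 : f v0 = v0.
  by rewrite /f /refl v0s mulr0 oppr0 scale0r addr0 v0t mulr0 oppr0 scale0r addr0.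
have it0 : iter m f v0 = v0 by elim: (m) => //= k ->.
have -> : v = v0 + (x *: alpha s + y *: alpha t).
  rewrite /v0 -addrA (_ : _ + (x *: _ + _) = 0) ?addr0 //.
  by rewrite addrACA -!scalerDl !addNr !scale0r addr0.
by rewrite itD it0 itD !itZ ita itb.
Qed.

Definition refl_mx (s : W) : 'M[R]_n :=
  1%:M + (\col_j (2 * cos (angle s (enum_val j)))) *m alpha s.

Lemma mul_refl_mx s v : v *m refl_mx s = refl s v.
Proof.
rewrite /refl_mx mulmxDr mulmx1 mulmxA /refl; congr (_ + _).
set u := v *m _; rewrite [u]mx11_scalar mul_scalar_mx; congr (GRing.scale _ _).
rewrite /u mxE /bform mulrN opprK mulr_sumr (reindex enum_rank) /=; last first.
  by exists enum_val => w _; [apply: enum_rankK | apply: enum_valK].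
by apply: eq_bigr => w _; rewrite mxE enum_rankK; ring.
Qed.

Lemma refl_unit s : s \in S -> refl_mx s \in unitmx.
Proof.
move=> Ss; have h : refl_mx s *m refl_mx s = 1%:M.
  apply/row_matrixP => i; rewrite row_mul !rowE -mulmxA mulmxA !mul_refl_mx.
  by rewrite reflK // mulmx1.
by have [] := mulmx1_unit h.
Qed.

Definition refl_GL (s : W) : GLmx R n := insubd (GLone R n) (refl_mx s).

Lemma refl_GLE s : s \in S -> val (refl_GL s) = refl_mx s.
Proof. by move=> Ss; rewrite val_insubd refl_unit. Qed.

Lemma ex_rep : exists act : W -> V -> V,
  [/\ forall w u v, act w (u + v) = act w u + act w v,
      forall w a v, act w (a *: v) = a *: act w v,
      forall v, act 1%g v = v,
      forall x y v, act (x * y)%g v = act x (act y v) &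
      forall s v, s \in S -> act s v = refl s v].
Proof.
have [_ _ univ] := coxW.
have [|phi phiM phiS] := univ (GLmx R n : groupType) refl_GL.
  move=> s t Ss St; apply: val_inj; apply/row_matrixP => i; rewrite !rowE.
  set d := delta_mx _ _.
  have -> k : d *m val ((refl_GL s * refl_GL t) ^+ k)%g =
      iter k (fun v => refl t (refl s v)) d.
    elim: k => [|k IH]; first by rewrite expg0 /= mulmx1.
    rewrite expgSr /= mulmxA IH -!mul_refl_mx !refl_GLE // mulmxA.
    by [].
  by rewrite refl_order // mulmx1.
(* Matrices multiply row vectors on the right; the inverse makes this a left action. *)
exists (fun w v => v *m val (phi w^-1)%g); split=> [w u v|w a v|v|x y v|s v Ss].
- by rewrite mulmxDl.
- by rewrite scalemxAl.
- have phi1 : phi 1%g = 1%g by apply: (mulgI (phi 1%g)); rewrite -phiM !mulg1.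
  by rewrite invg1 phi1 /= mulmx1.
- by rewrite invMg phiM /= mulmxA.
by rewrite (invS cox_ord Ss) phiS // refl_GLE // mul_refl_mx.
Qed.

End Rep.

(** * Positivity of roots and an invariant scalar product *)

Section Roots.
Local Open Scope ring_scope.
Variables (R : realType) (W : finGroupType) (S : {set W}).
Hypothesis coxW : coxeter_system S.
Local Notation n := #|W|.
Local Notation V := 'rV[R]_n.
Local Notation len := (cox_length S).
Local Notation mm s t := (#[s * t])%g.
Let gS := cox_gen coxW.
Let oS := cox_ord coxW.
Local Notation alpha := (alpha R (W := W)).
Local Notation angle := (angle R).

Variable act : W -> V -> V.
Hypothesis actD : forall w u v, act w (u + v) = act w u + act w v.
Hypothesis actZ : forall w a v, act w (a *: v) = a *: act w v.
Hypothesis act1 : forall v, act 1%g v = v.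
Hypothesis actM : forall x y v, act (x * y)%g v = act x (act y v).
Hypothesis actS : forall s v, s \in S -> act s v = refl s v.

Lemma alt_root s t k : s \in S -> t \in S ->
  sin (angle s t) *: act (alt s t k) (alpha s) =
  sin (angle s t *+ k.+1) *: alpha (if odd k then t else s) +
  sin (angle s t *+ k) *: alpha (if odd k then s else t).
Proof.
move=> Ss St; elim: k => [|k IH].
  by rewrite act1 mulr1n mulr0n sin0 scale0r addr0.
rewrite alt_headE actM -actZ IH /= !if_neg.
set c := if odd k then s else t; set d := if odd k then t else s.
have Sc : c \in S by rewrite /c; case: ifP.
have Sd : d \in S by rewrite /d; case: ifP.
have cdE : angle c d = angle s t.
  by rewrite /c /d; case: (odd k) => //; apply: (angleC R coxW).
have := refl_sin coxW (angle s t *+ k) Sc Sd; rewrite cdE actS //.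
have -> : angle s t *+ k + angle s t *+ 2 = angle s t *+ k.+2 by rewrite -mulrnDr addn2.
by rewrite -mulrSr => ->; rewrite addrC.
Qed.

(* Write w = v d, where d is the longest alternating word in s and t such that  *)
(* the lengths add up, and use induction for v: v (alpha s) and v (alpha t) are *)
(* positive, and w (alpha s) is a combination of them with coefficients         *)
(* sin (j th) / sin th.                                                         *)
Theorem root_pos (f : V -> R) :
  (forall u v, f (u + v) = f u + f v) -> (forall a v, f (a *: v) = a * f v) ->
  (forall s, s \in S -> 0 < f (alpha s)) ->
  forall w s, s \in S -> (len w <= len (w * s)%g)%N -> 0 < f (act w (alpha s)).
Proof.
move=> fD fZ fpos w; have [m] := ubnP (len w); elim: m w => // m IH w.
rewrite ltnS => lem s Ss les.
have [->|/(len_descent gS oS)[t St lt_t]] := eqVneq w 1%g; first by rewrite act1 fpos.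
have st : s != t by apply: contraTneq lt_t => <-; rewrite -leqNgt.
pose P k := (len (w * (alt s t k)^-1)%g + k == len w)%N.
have P1 : P 1%N.
  rewrite /P /= mul1g (invS oS St) addn1 eqn_leq lt_t /=.
  exact: (lenMS_ge gS oS).
have Pbd k : P k -> (k <= len w)%N by move=> /eqP <-; rewrite leq_addl.
have [k /eqP Pk maxk] := ex_maxnP (ex_intro _ 1%N P1) Pbd.
have k1 : (0 < k)%N by apply: maxk.
have [v vE] : exists v, v = (w * (alt s t k)^-1)%g by exists (w * (alt s t k)^-1)%g.
have wE : w = (v * alt s t k)%g by rewrite vE mulgKV.
have ltv : (len v < len w)%N by rewrite -Pk -vE -addn1 leq_add2l.
have ltm : (len v < m)%N by apply: leq_trans ltv lem.
pose c := if odd k then s else t; pose d := if odd k then t else s.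
have Sc : c \in S by rewrite /c; case: ifP.
have Sd : d \in S by rewrite /d; case: ifP.
(* [c] is the letter that would prolong the alternating word, so this follows from the maximality of
   k. *)
have vc : (len v <= len (v * c)%g)%N.
  rewrite leqNgt; apply/negP => lt_c.
  have : P k.+1.
    rewrite /P alt_headE invMg (invS oS Sc) mulgA -vE addnS -addSn -Pk -vE eqn_add2r.
    by rewrite eqn_leq lt_c (lenMS_ge gS oS).
  by move/maxk; rewrite ltnn.
(* [d] is the first letter of the word; absorbing it into v would otherwise make w too short. *)
have vd : (len v <= len (v * d)%g)%N.
  rewrite leqNgt; apply/negP => lt_d.
  have altE : alt s t k = (d * alt s t k.-1)%g.
    have ok : odd k = ~~ odd k.-1 by rewrite -{1}(prednK k1).
    by rewrite -{1}(prednK k1) alt_headE /d ok if_neg.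
  have : (len w <= len (v * d)%g + k.-1)%N.
    rewrite wE altE mulgA; apply: leq_trans (lenM gS _ _) _.
    by rewrite leq_add2l (len_alt gS).
  rewrite leqNgt -Pk -vE; apply/negP; rewrite negbK.
  apply: leq_trans (_ : (len v + k.-1 < _)%N); first by rewrite ltnS leq_add2r ltnW.
  by rewrite ltn_add2l prednK.
(* For k >= m the braid relation would let the word end in s, making w s shorter than w. *)
have km : (k < mm s t)%N.
  rewrite ltnNge; apply/negP => mk; set m' := mm s t in mk.
  have m'1 : (0 < m')%N by rewrite order_gt0.
  have [x altE lex] := alt_prefix gS oS (k - m') m' Ss St.
  rewrite subnK // in altE.
  have br : alt s t m' = alt t s m' by apply: (alt_braid oS) => //; apply: expg_order.
  have : (len (w * s)%g <= len v + (k - m' + m'.-1))%N.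
    rewrite wE altE br -(prednK m'1) /= -!mulgA (mulSS oS Ss) mulg1.
    apply: leq_trans (lenM gS _ _) _; rewrite leq_add2l.
    apply: leq_trans (lenM gS _ _) _; apply: leq_add;
      [by rewrite prednK|exact: (len_alt gS)].
  apply/negP; rewrite -ltnNge; apply: leq_trans les; rewrite -Pk -vE ltn_add2l.
  by rewrite -{2}(subnK mk) ltn_add2l prednK.
have s0 : 0 < sin (angle s t).
  rewrite -[angle s t]mulr1n; apply: (@sin_angle R W S) => //.
  by rewrite (order_mul_gt1 coxW).
rewrite -(pmulr_rgt0 _ s0) -fZ -actZ [X in act X]wE actM actZ alt_root // actD !actZ fD !fZ.
rewrite -/c -/d; apply: ltr_wpDl.
  rewrite mulr_ge0 ?(ltW (IH _ ltm _ Sd vd)) //.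
  have [km'|mk] := ltnP k.+1 (mm s t).
    by rewrite ltW // (@sin_angle R W S).
  have -> : k.+1 = mm s t by apply/eqP; rewrite eqn_leq km mk.
  rewrite /angle -[_ *+ _]mulr_natr mulfVK ?sinpi //.
  by rewrite pnatr_eq0 -lt0n order_gt0.
by rewrite mulr_gt0 ?(IH _ ltm _ Sc vc) // (@sin_angle R W S) // k1.
Qed.

Definition dot (x y : V) : R := \sum_i x 0 i * y 0 i.
(** Averaging gives an invariant scalar product without any positivity of the Coxeter form. *)
Definition iform (x y : V) : R := \sum_w dot (act w x) (act w y).

Lemma dotDl x y z : dot (x + y) z = dot x z + dot y z.
Proof. by rewrite /dot -big_split; apply: eq_bigr => i _; rewrite mxE mulrDl. Qed.
Lemma dotZl a x z : dot (a *: x) z = a * dot x z.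
Proof. by rewrite /dot mulr_sumr; apply: eq_bigr => i _; rewrite mxE mulrA. Qed.
Lemma dotC x y : dot x y = dot y x.
Proof. by apply: eq_bigr => i _; rewrite mulrC. Qed.
Lemma dot_ge (x : V) i : (x 0 i) ^+ 2 <= dot x x.
Proof.
rewrite /dot (bigD1 i) //= -expr2 lerDl; apply: sumr_ge0 => j _.
by rewrite -expr2 sqr_ge0.
Qed.

Lemma iformDl x y z : iform (x + y) z = iform x z + iform y z.
Proof. by rewrite /iform -big_split; apply: eq_bigr => w _; rewrite actD dotDl. Qed.
Lemma iformZl a x z : iform (a *: x) z = a * iform x z.
Proof. by rewrite /iform mulr_sumr; apply: eq_bigr => w _; rewrite actZ dotZl. Qed.
Lemma iformC x y : iform x y = iform y x.
Proof. by apply: eq_bigr => w _; rewrite dotC. Qed.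
Lemma iform_ge (x : V) i : (x 0 i) ^+ 2 <= iform x x.
Proof.
rewrite /iform (bigD1 1%g) //= act1; apply: le_trans (dot_ge x i) _.
rewrite lerDl; apply: sumr_ge0 => w _.
by apply: sumr_ge0 => j _; rewrite -expr2 sqr_ge0.
Qed.
Lemma iform_act w x y : iform (act w x) (act w y) = iform x y.
Proof.
rewrite /iform [RHS](reindex_inj (mulIg w)) /=.
by apply: eq_bigr => u _; rewrite !actM.
Qed.

(** The Gram matrix of the basis is invertible, so all these products can be prescribed to be 1. *)
Lemma ex_dominant : exists x0, forall w, 0 < iform x0 (alpha w).
Proof.
have iformDr x y z : iform z (x + y) = iform z x + iform z y by rewrite iformC iformDl
  !(iformC z).
have iformZr a x z : iform z (a *: x) = a * iform z x by rewrite iformC iformZl !(iformC z).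
have iform0 x : iform 0 x = 0 by rewrite -(scale0r 0) iformZl mul0r.
pose e i : V := delta_mx 0 i.
pose G : 'M[R]_n := \matrix_(i, j) iform (e i) (e j).
have GE x j : (x *m G) 0 j = iform x (e j).
  rewrite mxE [in RHS](row_sum_delta x).
  rewrite (big_morph (iform^~ (e j)) (fun x y => iformDl x y (e j)) (iform0 _)).
  by apply: eq_bigr => i _; rewrite mxE iformZl.
have unitG : G \in unitmx.
  rewrite -row_free_unit; apply: inj_row_free => x xG.
  have f0 : iform x x = 0.
    rewrite {2}(row_sum_delta x) (big_morph (iform x) (fun y z => iformDr y z x) (id1 :=
      0)).
      by rewrite big1 // => i _; rewrite iformZr -GE xG mxE mulr0.
    by rewrite iformC iform0.
  apply/rowP => i; rewrite mxE; apply/eqP; rewrite -sqrf_eq0 eq_le sqr_ge0 andbT.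
  by rewrite -f0 iform_ge.
exists (const_mx 1 *m invmx G) => w.
by rewrite /alpha -/(e _) -GE mulmxKV // mxE ltr01.
Qed.

Section Twist.
Variable a : {perm W}.
Hypothesis autA : a \in Aut [set: W].
Hypothesis aS : {in S, forall s, a s \in S}.

Lemma autM x y : a (x * y)%g = (a x * a y)%g.
Proof. by have /morphicP := Aut_morphic autA; apply; rewrite inE. Qed.

Lemma order_aut x : #[a x]%g = #[x]%g.
Proof. by rewrite -(order_injm (injm_autm autA) (finset.in_setT x)). Qed.

Definition twist (v : V) : V := \row_j v 0 (enum_rank ((a^-1)%g (enum_val j))).

Lemma twistD u v : twist (u + v) = twist u + twist v.
Proof. by apply/rowP => j; rewrite !mxE. Qed.
Lemma twistZ c v : twist (c *: v) = c *: twist v.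
Proof. by apply/rowP => j; rewrite !mxE. Qed.
Lemma twist_alpha w : twist (alpha w) = alpha (a w).
Proof.
apply/rowP => j; rewrite !mxE eqxx /=; congr (_%:R); congr nat_of_bool.
rewrite (inj_eq enum_rank_inj) -(inj_eq (perm_inj (s := a))) permKV.
by rewrite -(inj_eq enum_rank_inj) enum_valK.
Qed.

Lemma bform_twist s v : bform (a s) (twist v) = bform s v.
Proof.
rewrite /bform; congr (- _); rewrite (reindex_inj (perm_inj (s := a))).
apply: eq_bigr => w _; rewrite mxE enum_rankK permK.
by rewrite /angle -autM order_aut.
Qed.

Lemma twistA w v : twist (act w v) = act (a w) (twist v).
Proof.
have := len_mem gS w; move: (len w) => k; elim: k w => [|k IH] w.
  rewrite expg0 => /set1P ->; rewrite act1.
  by have -> : a 1%g = 1%g; [apply: (mulgI (a 1%g)); rewrite -autM !mulg1 | rewrite act1].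
rewrite expgS => /mulsgP[s y Ss Sy ->];
  rewrite autM !actM -IH // [act s _]actS // [act (a s) _]actS ?aS //.
by rewrite /refl twistD twistZ twist_alpha bform_twist.
Qed.

Lemma iform_twist x y : iform (twist x) (twist y) = iform x y.
Proof.
have dot_twist u v : dot (twist u) (twist v) = dot u v.
  rewrite /dot [LHS](reindex (fun i : 'I_n => enum_rank (a (enum_val i)))) /=; last first.
    exists (fun i => enum_rank ((a^-1)%g (enum_val i))) => i _.
      by rewrite enum_rankK permK enum_valK.
    by rewrite enum_rankK permKV enum_valK.
  by apply: eq_bigr => i _; rewrite !mxE enum_rankK permK enum_valK.
rewrite /iform (reindex_inj (perm_inj (s := a))) /=.
by apply: eq_bigr => w _; rewrite -!twistA dot_twist.
Qed.

End Twist.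

Lemma twistK a : cancel (twist (a^-1)%g) (twist a).
Proof. by move=> v; apply/rowP => j; rewrite !mxE enum_rankK invgK permKV enum_valK. Qed.

End Roots.

(** * Signs of roots and lengths *)

Section Signs.
Local Open Scope ring_scope.
Variables (R : realType) (W : finGroupType) (S : {set W}).
Hypothesis coxW : coxeter_system S.
Local Notation n := #|W|.
Local Notation V := 'rV[R]_n.
Local Notation len := (cox_length S).
Let gS := cox_gen coxW.
Let oS := cox_ord coxW.
Local Notation alpha := (alpha R (W := W)).

Variable act : W -> V -> V.
Hypothesis actD : forall w u v, act w (u + v) = act w u + act w v.
Hypothesis actZ : forall w a v, act w (a *: v) = a *: act w v.
Hypothesis act1 : forall v, act 1%g v = v.
Hypothesis actM : forall x y v, act (x * y)%g v = act x (act y v).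
Hypothesis actS : forall s v, s \in S -> act s v = refl s v.
Local Notation iform := (iform act).
Let root_pos := root_pos coxW actD actZ act1 actM actS.
Let fDl := iformDl actD.
Let fZl := iformZl actZ.
Let fC := iformC act.
Let fact := iform_act actM.

(* By dominant_side, this says that the root r (alpha s) is positive. *)
Definition positive (r s : W) := (len r < len (r * s)%g)%N.

Lemma actN w v : act w (- v) = - act w v.
Proof. by rewrite -scaleN1r actZ scaleN1r. Qed.

Lemma actK w v : act w^-1%g (act w v) = v.
Proof. by rewrite -actM mulVg act1. Qed.
Lemma actKV w v : act w (act w^-1%g v) = v.
Proof. by rewrite -actM mulgV act1. Qed.

Lemma act_alphaS w s : s \in S -> act (w * s)%g (alpha s) = - act w (alpha s).
Proof. by move=> Ss; rewrite actM (actS _ Ss) (refl_ss R coxW) // actN. Qed.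

(** [root_pos] applies to w or to w s, which send alpha s to opposite vectors; in particular their
    lengths differ. *)
Lemma root_side (f : V -> R) :
  (forall u v, f (u + v) = f u + f v) -> (forall a v, f (a *: v) = a * f v) ->
  (forall s, s \in S -> 0 < f (alpha s)) -> forall w s, s \in S ->
  f (act w (alpha s)) != 0 /\ (0 < f (act w (alpha s))) = positive w s.
Proof.
move=> fD fZ fpos w s Ss; rewrite /positive.
have fN v : f (- v) = - f v by rewrite -scaleN1r fZ mulN1r.
have [le|lt] := leqP (len w) (len (w * s)%g).
  have h := root_pos fD fZ fpos Ss le; rewrite gt_eqF // h.
  rewrite ltn_neqAle le andbT; split=> //; apply/esym/eqP => eql.
  have : 0 < f (act (w * s)%g (alpha s)).
    by apply: root_pos; rewrite // (mulKS oS) // eql.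
  by rewrite act_alphaS // fN oppr_gt0 ltNge ltW.
have : 0 < f (act (w * s)%g (alpha s)) by apply: root_pos; rewrite // (mulKS oS) // ltnW.
rewrite act_alphaS // fN oppr_gt0 => h.
by rewrite lt_eqF // [0 < _]ltNge ltW // ltnNge ltnW.
Qed.

Definition dominant y := forall s, s \in S -> 0 < iform y (alpha s).

Lemma dominant_side y w s : dominant y -> s \in S ->
  iform y (act w (alpha s)) != 0 /\ (0 < iform y (act w (alpha s))) = positive w s.
Proof.
move=> dy Ss; apply: (root_side (f := iform y)) => // [u v|a v].
  by rewrite fC fDl !(fC _ y).
by rewrite fC fZl fC.
Qed.

Lemma positive1 s : s \in S -> positive 1 s.
Proof.
move=> Ss; rewrite /positive mul1g len1 // lt0n; apply/eqP => /(len_eq0 gS) s1.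
by have := oS Ss; rewrite s1 order1.
Qed.

Lemma positive_mulS r s : s \in S -> positive (r * s)%g s = ~~ positive r s.
Proof.
move=> Ss; have [x0 x0P] := ex_dominant actD actZ act1.
have d0 : dominant x0 by move=> t _; apply: x0P.
have [_ <-] := dominant_side (r * s)%g d0 Ss; have [h0 <-] := dominant_side r d0 Ss.
rewrite act_alphaS // fC -scaleN1r fZl fC mulN1r oppr_gt0.
by case: (ltrgt0P (iform x0 _)) h0.
Qed.

Lemma len_neg r s : s \in S -> ~~ positive r s -> (len (r * s)%g < len r)%N.
Proof. by move=> Ss; rewrite -positive_mulS // /positive (mulKS oS). Qed.

(* Testing against the functionals "sum of coordinates + N * (coordinate w)"    *)
(* shows that only the coordinate t of r (alpha s) survives.                    *)
Lemma simple_flip r s t : s \in S -> t \in S -> positive r s -> ~~ positive (t * r)%g s ->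
  exists2 k, 0 < k & act r (alpha s) = k *: alpha t.
Proof.
move=> Ss St pr npr; set be := act r (alpha s).
pose f (c v : V) := \sum_i c 0 i * v 0 i.
have fD c u v : f c (u + v) = f c u + f c v.
  by rewrite /f -big_split; apply: eq_bigr => i _; rewrite mxE mulrDr.
have fZ c a v : f c (a *: v) = a * f c v.
  by rewrite /f mulr_sumr; apply: eq_bigr => i _; rewrite mxE mulrCA.
have fa c w : f c (alpha w) = c 0 (enum_rank w).
  rewrite /f (bigD1 (enum_rank w)) //= big1 ?addr0 => [|i iw].
    by rewrite mxE !eqxx mulr1.
  by rewrite mxE (negbTE iw) mulr0.
have key (c : V) : (forall w, 0 < c 0 (enum_rank w)) ->
    0 < f c be /\ f c be < 2 * bform t be * c 0 (enum_rank t).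
  move=> cpos; have fp s' : s' \in S -> 0 < f c (alpha s') by rewrite fa.
  have [h0 h1] := root_side (fD c) (fZ c) fp r Ss.
  have [h2 h3] := root_side (fD c) (fZ c) fp (t * r)%g Ss.
  rewrite -/be in h0 h1; split; first by rewrite h1.
  move: h2 h3; rewrite actM -/be (actS _ St) /refl fD fZ fa (negbTE npr) => h2 h3.
  have : f c be + - (2 * bform t be) * c 0 (enum_rank t) < 0.
    by rewrite lt_neqAle h2 leNgt h3.
  by rewrite mulNr subr_lt0.
pose c1 (w : W) N : V := \row_i (1 + N * (i == enum_rank w)%:R).
have c1p w N : 0 <= N -> forall u, 0 < c1 w N 0 (enum_rank u).
  by move=> N0 u; rewrite mxE ltr_wpDr // mulr_ge0 ?ler0n.
have fc1 w N : f (c1 w N) be = f (const_mx 1) be + N * be 0 (enum_rank w).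
  rewrite /f [in RHS](bigD1 (enum_rank w)) //= [LHS](bigD1 (enum_rank w)) //= !mxE eqxx.
  rewrite mulr1 mulrDl mul1r -!addrA; congr (_ + _); rewrite [RHS]addrC; congr (_ + _).
  by apply: eq_bigr => i iw; rewrite !mxE (negbTE iw) mulr0 addr0.
have be0 w : w != t -> be 0 (enum_rank w) = 0.
  move=> wt; set A := f (const_mx 1) be in fc1; set B := 2 * bform t be.
  have h N : 0 <= N -> 0 < A + N * be 0 (enum_rank w) /\ A + N * be 0 (enum_rank w) < B.
    move=> N0; have [] := key (c1 w N) (c1p w N N0); rewrite fc1.
    by rewrite mxE (inj_eq enum_rank_inj) eq_sym (negbTE wt) mulr0 addr0 mulr1.
  set q := be 0 (enum_rank w) in h *.
  have := h 0 (lexx _); rewrite mul0r addr0 => -[A0 AB].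
  have [q0|q0|//] := ltrgt0P q.
    have := h ((B - A) / q); rewrite divr_ge0 ?subr_ge0 ?ltW // => /(_ isT)[_].
    by rewrite mulfVK ?gt_eqF // addrC subrK ltxx.
  have := h (- A / q); rewrite mulfVK ?lt_eqF // subrr ltxx.
  by rewrite -mulrNN opprK -invrN divr_ge0 ?oppr_ge0 ?ltW // => /(_ isT)[].
exists (be 0 (enum_rank t)).
  have [] := key (c1 t 0) (c1p t 0 (lexx _)); rewrite fc1 mul0r addr0 => + _.
  rewrite /f (bigD1 (enum_rank t)) //= big1 ?addr0 => [|i it]; first by rewrite mxE mul1r.
  have -> : i = enum_rank (enum_val i) by rewrite enum_valK.
  by rewrite be0 ?mulr0 //; apply: contra it => /eqP <-; rewrite enum_valK.
apply/rowP => i; rewrite !mxE eqxx /=.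
have [->|it] := eqVneq i (enum_rank t); first by rewrite mulr1.
rewrite mulr0 -[i]enum_valK be0 //; apply: contra it => /eqP <-.
by rewrite enum_valK.
Qed.

(** A nontrivial element has a descent, hence makes some simple root negative. *)
Lemma act_inj x y : (forall v, act x v = act y v) -> x = y.
Proof.
move=> xy; apply/eqP; rewrite eq_mulVg1; apply: contraT => /(len_descent gS oS)[s Ss].
have [x0 x0P] := ex_dominant actD actZ act1.
have d0 : dominant x0 by move=> t _; apply: x0P.
have [_] := dominant_side (x^-1 * y)%g d0 Ss.
by rewrite actM -xy actK x0P /positive => /esym; rewrite ltnNge => /negP h /ltnW.
Qed.

Lemma bformE s v : s \in S ->
  2 * bform s v = 2 * iform v (alpha s) / iform (alpha s) (alpha s).
Proof.
move=> Ss; have : iform (act s v) (act s (alpha s)) = iform v (alpha s) by apply: fact.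
rewrite !(actS _ Ss) (refl_ss R coxW) // fC -scaleN1r fZl /refl fC fDl fZl => h.
have as0 : iform (alpha s) (alpha s) != 0.
  rewrite gt_eqF //; apply: lt_le_trans (iform_ge act1 _ (enum_rank s)).
  by rewrite mxE !eqxx expr1n ltr01.
apply: (mulIf as0); rewrite mulfVK //.
move: h; set p := iform v _; set q := iform (alpha s) _; lra.
Qed.

Lemma refl_conj r s t k : s \in S -> t \in S -> act r (alpha s) = k *: alpha t ->
  (t * r = r * s)%g.
Proof.
move=> Ss St rs; apply: act_inj => v; rewrite !actM (actS v Ss) (actS _ St) /refl.
rewrite actD actZ rs scalerA; congr (_ + GRing.scale _ _); rewrite mulNr.
congr (- _); rewrite !bformE //.
have k0 : k != 0.
  apply: contra_eq_neq rs => ->; rewrite scale0r.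
  have [x0 x0P] := ex_dominant actD actZ act1.
  have d0 : dominant x0 by move=> u _; apply: x0P.
  have [h _] := dominant_side r d0 Ss; apply: contraNneq h => ->.
  by rewrite fC -(scale0r 0) fZl mul0r.
rewrite -[iform v _](fact r) -[iform (alpha s) _](fact r) rs.
have fZr a x z : iform z (a *: x) = a * iform z x by rewrite fC fZl fC.
rewrite fZl !fZr; set p := iform (act r v) _; set q := iform (alpha t) _.
have q0 : q != 0.
  rewrite gt_eqF //; apply: lt_le_trans (iform_ge act1 _ (enum_rank t)).
  by rewrite mxE !eqxx expr1n ltr01.
by field; rewrite q0 k0.
Qed.

(** The hypothesis says that no positive root is made negative by y and positive again by x. It
    passes from y to y t, for t a descent of y, by replacing r with t r; the only root whose sign
    this changes is proportional to alpha t, by [simple_flip], and y t keeps it positive. *)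
Lemma len_add x y :
  (forall r s, s \in S -> positive r s -> ~~ positive (y * r)%g s ->
     positive (x * y * r)%g s -> False) ->
  len (x * y)%g = (len x + len y)%N.
Proof.
have [m] := ubnP (len y); elim: m y => // m IH y; rewrite ltnS => lem hyp.
have [->|/(len_descent gS oS)[t St lt_t]] := eqVneq y 1%g;
  first by rewrite mulg1 len1 // addn0.
have Nyt : ~~ positive y t by rewrite /positive -leqNgt ltnW.
have lenyt : (len (y * t)%g).+1 = len y.
  by apply/eqP; rewrite eqn_leq lt_t (lenMS_ge gS oS).
have Nxyt : ~~ positive (x * y)%g t.
  by apply/negP => h; apply: (hyp 1%g t) => //; rewrite ?mulg1 ?positive1.
have lenxyt : (len (x * y * t)%g).+1 = len (x * y)%g.
  by apply/eqP; rewrite eqn_leq len_neg // (lenMS_ge gS oS).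
rewrite -lenxyt -lenyt addnS -mulgA; congr _.+1; apply: IH.
  by apply: leq_trans lem; rewrite -lenyt.
move=> r s Ss pr nyr pxyr; have [ptr|ntr] := boolP (positive (t * r)%g s).
  by apply: (hyp (t * r)%g s) => //; rewrite !mulgA // -!mulgA // !mulgA in nyr pxyr *.
have [k k0 rk] := simple_flip Ss St pr ntr.
have [x0 x0P] := ex_dominant actD actZ act1.
have d0 : dominant x0 by move=> u _; apply: x0P.
have [_ h1] := dominant_side (y * t * r)%g d0 Ss;
  have [_ h2] := dominant_side (y * t)%g d0 St.
move: h1; rewrite actM rk actZ fC fZl fC pmulr_rgt0 // h2 positive_mulS // (negbTE nyr).
by rewrite Nyt.
Qed.

(** The positive root u s (alpha s) is made negative by t, so it is a multiple of alpha t, and t (u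
    s) = (u s) s. *)
Lemma cyc_fix u s t : s \in S -> t \in S -> (len (u * s)%g < len u)%N ->
  (len (t * u)%g < len u)%N -> len (t * u * s)%g = len u -> (t * u * s)%g = u.
Proof.
move=> Ss St l1 l2 l3.
have p1 : positive (u * s)%g s by rewrite /positive (mulKS oS).
have p2 : ~~ positive (t * (u * s))%g s.
  by rewrite /positive !mulgA (mulKS oS) // -leqNgt l3 ltnW.
have [k _ h] := simple_flip Ss St p1 p2.
by have := refl_conj Ss St h; rewrite mulgA (mulKS oS) // => ->.
Qed.

End Signs.

(** * Twisted conjugacy and chambers *)

Section TwistedClass.
Local Open Scope group_scope.
Variables (W : finGroupType) (S : {set W}) (a : {perm W}).
Local Notation len := (cox_length S).

(* In the coset of a power of delta that acts as a on W, conjugation by x is    *)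
(* the twisted conjugation u |-> a x * u * x^-1 of the component in W.          *)
Definition twisted_shift u v :=
  v = u \/ exists2 s, s \in S & v = a s * u * s /\ len v <= len u.
Definition twisted_strong u v := v = u \/ (len u = len v /\ exists x, v = a x * u * x^-1 /\
  (len (a x * u) = len x + len u \/ len (u * x^-1) = len x + len u)).

End TwistedClass.

Section Chambers.
Local Open Scope ring_scope.
Variables (R : realType) (W : finGroupType) (S : {set W}).
Hypothesis coxW : coxeter_system S.
Local Notation n := #|W|.
Local Notation V := 'rV[R]_n.
Local Notation len := (cox_length S).
Let gS := cox_gen coxW.
Let oS := cox_ord coxW.
Local Notation alpha := (alpha R (W := W)).

Variable act : W -> V -> V.
Hypothesis actD : forall w u v, act w (u + v) = act w u + act w v.
Hypothesis actZ : forall w a v, act w (a *: v) = a *: act w v.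
Hypothesis act1 : forall v, act 1%g v = v.
Hypothesis actM : forall x y v, act (x * y)%g v = act x (act y v).
Hypothesis actS : forall s v, s \in S -> act s v = refl s v.
Local Notation iform := (iform act).
Local Notation positive := (positive S).

Variables (a : {perm W}) (w0 : W).
Hypothesis autA : a \in Aut [set: W].
Hypothesis aS : {in S, forall s, a s \in S}.
Local Notation a' := (a^-1)%g.

Let fDl := iformDl actD.
Let fZl := iformZl actZ.
Let fC := iformC act.
Let fact := iform_act actM.
Let dsg := dominant_side coxW actD actZ act1 actM actS.
Let aM := autM autA.

Lemma autV : a' \in Aut [set: W]. Proof. by rewrite groupV. Qed.

Lemma aVS : {in S, forall s, a' s \in S}.
Proof.
move=> s Ss; have aSS : a @: S = S.
  apply/eqP; rewrite finset.eqEcard card_imset ?leqnn ?andbT; last exact: perm_inj.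
  by apply/fintype.subsetP => _ /imsetP[t St ->]; apply: aS.
by have := Ss; rewrite -{1}aSS => /imsetP[t St ->]; rewrite permK.
Qed.

Lemma aut1 : a 1%g = 1%g.
Proof. by apply: (mulgI (a 1%g)); rewrite -aM !mulg1. Qed.
Lemma autVg x : a (x^-1)%g = ((a x)^-1)%g.
Proof. by apply: (mulgI (a x)); rewrite -aM !mulgV aut1. Qed.

Lemma len_autE w : len (a w) = len w.
Proof.
apply/eqP; rewrite eqn_leq len_aut //=.
by have := len_aut gS (a w) autV aVS; rewrite permK.
Qed.

Lemma positive_aut r s : positive (a r) (a s) = positive r s.
Proof. by rewrite /positive -aM !len_autE. Qed.

(* The action on V of the element of the twisted group with components (a, w0). *)
Definition tw (v : V) : V := twist a' (act w0 v).
Definition twV (v : V) : V := act w0^-1%g (twist a v).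
Definition root (i : W * W) : V := act i.1 (alpha i.2).
Definition roots : {set W * W} := [set i | i.2 \in S].

Lemma twD u v : tw (u + v) = tw u + tw v. Proof. by rewrite /tw actD twistD. Qed.
Lemma twZ c v : tw (c *: v) = c *: tw v. Proof. by rewrite /tw actZ twistZ. Qed.
Lemma twK : cancel tw twV.
Proof. by move=> v; rewrite /tw /twV twistK -actM mulVg act1. Qed.
Lemma twVK : cancel twV tw.
Proof.
by move=> v; rewrite /tw /twV -actM mulgV act1 -{2}[a]invgK twistK.
Qed.
Lemma iform_tw x y : iform (tw x) (tw y) = iform x y.
Proof. by rewrite /tw (iform_twist coxW act1 actM actS autV aVS) fact. Qed.

Lemma alphaN0 w : alpha w != 0.
Proof.
apply/eqP => /rowP/(_ (enum_rank w)); rewrite !mxE !eqxx => /eqP.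
by rewrite oner_eq0.
Qed.

Lemma rootN0 i : root i != 0.
Proof.
apply: contraNneq (alphaN0 i.2) => e0.
have := actK act1 actM i.1 (alpha i.2); rewrite -/(root i) e0 => <-.
by rewrite -[X in act _ X](scale0r (0 : V)) actZ scale0r.
Qed.

Lemma iform_pos x : x != 0 -> 0 < iform x x.
Proof.
move=> xN0; have [i xi] : exists i, x 0 i != 0.
  by apply/existsP; apply: contraNT xN0 => /existsPn h; apply/eqP/rowP => i;
    rewrite mxE; apply/eqP/negPn/h.
by apply: lt_le_trans (iform_ge act1 x i); rewrite exprn_even_gt0.
Qed.

Lemma iform_tw_root x z s : iform (tw x) (root (z, s)) = iform x (root (w0^-1 * a z, a
  s)%g).
Proof.
rewrite /root /= -(iform_twist coxW act1 actM actS autA aS) /tw twistK.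
by rewrite (twistA coxW act1 actM actS autA aS) twist_alpha actM -[RHS](fact w0) (actKV
  act1 actM).
Qed.

Lemma iform_twV_root x z s : iform (twV x) (root (z, s)) = iform x (root (a' (w0 * z), a'
  s)%g).
Proof.
rewrite -iform_tw twVK /root /= /tw -actM.
by rewrite (twistA coxW act1 actM actS autV aVS) twist_alpha.
Qed.

Local Notation stable_by := (stable_by iform root).
Local Notation stable := (stable iform root tw twV).

Lemma stable_roots : stable roots.
Proof.
split=> -[z s]; rewrite inE /= => Ss.
  exists (w0^-1 * a z, a s)%g, 1; split; rewrite ?inE ?oner_eq0 ?aS //.
  by move=> x; rewrite mul1r iform_tw_root.
exists (a' (w0 * z), a' s)%g, 1; split; rewrite ?inE ?oner_eq0 ?aVS //.
by move=> x; rewrite mul1r iform_twV_root.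
Qed.

Local Notation side := (side iform root).
Local Notation separates := (separates iform root).
Local Notation regular := (regular iform root).

(* y is in the chamber w C0 *)
Definition label y w := forall z s, s \in S -> side y (z, s) = positive (w^-1 * z)%g s.

(** The component in W of the conjugate by w^-1 of the element with components (a, w0), see
    [elt_conj]. *)
Definition tw_conj w := ((a w)^-1 * w0 * w)%g.

Lemma label_tw y w v s : label y w -> s \in S ->
  side (tw y) (w * v, s)%g = positive ((tw_conj w)^-1 * a v)%g (a s).
Proof.
move=> ly Ss; rewrite /side iform_tw_root -/(side y _) ly ?aS //.
by rewrite /tw_conj !invMg invgK aM !mulgA.
Qed.

Lemma label_twV y w v s : label y w -> s \in S ->
  side (twV y) (w * v, s)%g = positive (tw_conj w * v)%g s.
Proof.
move=> ly Ss; rewrite /side iform_twV_root -/(side y _) ly ?aVS //.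
by rewrite -positive_aut aM autVg !permKV /tw_conj !mulgA.
Qed.

Lemma label_self y w v s : label y w -> s \in S -> side y (w * v, s)%g = positive v s.
Proof. by move=> ly Ss; rewrite ly // mulKg. Qed.

Lemma ex_dom : exists2 x0, dominant S act x0 & regular roots x0.
Proof.
have [x0 x0P] := ex_dominant actD actZ act1.
have d0 : dominant S act x0 by move=> s _; apply: x0P.
by exists x0 => // -[z s]; rewrite inE /= => Ss; have [] := dsg z d0 Ss.
Qed.

Lemma dominant_label x0 w : dominant S act x0 -> regular roots (act w x0) /\
  label (act w x0) w.
Proof.
move=> d0; have E z s : iform (act w x0) (root (z, s)) = iform x0 (act (w^-1 * z)%g
  (alpha s)).
  by rewrite -[RHS](fact w) -actM mulKVg.
split=> [[z s]|z s Ss]; last by rewrite /side E; have [] := dsg (w^-1 * z)%g d0 Ss.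
by rewrite inE /= => Ss; rewrite E; have [] := dsg (w^-1 * z)%g d0 Ss.
Qed.

(** If w maximises the product of w y with a dominant vector, then w y is dominant, since a simple
    reflection could otherwise increase it. *)
Lemma ex_label y : regular roots y -> exists w, label y w.
Proof.
move=> ry; have [x0 d0 _] := ex_dom.
case: (@arg_maxP _ _ _ (1%g : W) xpredT (fun w => iform (act w y) x0) isT) => w _ wmax.
have dwy : dominant S act (act w y).
  move=> s Ss; have as0 := iform_pos (alphaN0 s).
  have wy0 : iform (act w y) (alpha s) != 0.
    have := ry (w^-1, s)%g; rewrite inE /= => /(_ Ss).
    by rewrite /root /= -[X in X != 0 -> _](fact w) (actKV act1 actM).
  rewrite lt_neqAle eq_sym wy0 /=.
  have := wmax (s * w)%g isT; rewrite /= actM (actS _ Ss) /refl fDl fZl.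
  rewrite (bformE coxW actD actZ act1 actM actS) // gerDl mulNr oppr_le0.
  rewrite [iform (alpha s) x0]fC pmulr_lge0; last exact: d0.
  by rewrite pmulr_lge0 ?invr_gt0 // pmulr_rge0.
exists w^-1%g => z s Ss; rewrite invgK.
have [_ <-] := dsg (w * z)%g dwy Ss.
by rewrite /side /root actM fact.
Qed.

Lemma separates_labels y y' w w' v s : label y w -> label y' w' -> s \in S ->
  separates y y' (w * v, s)%g = (positive v s != positive (w'^-1 * w * v)%g s).
Proof.
move=> ly ly' Ss; rewrite /separates (label_self v ly Ss) -{1}(mulKVg w' (w * v)%g).
by rewrite (label_self _ ly' Ss) mulgA.
Qed.

(** A descent s of w'^-1 w gives a separating wall. If w' is not w s, a further descent gives a
    second one, and the two roots are not proportional. *)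
Lemma single_label y y' w w' : label y w -> label y' w' ->
  single_wall iform root roots y y' ->
  w' = w \/ exists2 s, s \in S & w' = (w * s)%g /\ separates y y' (w * 1, s)%g.
Proof.
move=> ly ly' one; set c := (w'^-1 * w)%g.
have [c1|cN1] := eqVneq c 1%g.
  by left; apply/eqP; rewrite eq_sym -(inj_eq (mulgI w'^-1)%g) mulVg -/c c1.
have [s Ss lt_s] := len_descent gS oS cN1.
have sepE v t : t \in S ->
  separates y y' (w * v, t)%g = (positive v t != positive (c * v)%g t).
  by move=> St; rewrite (separates_labels v ly ly' St).
have Ncs : ~~ positive c s by rewrite /positive -leqNgt ltnW.
have seps : separates y y' (w * 1, s)%g.
  by rewrite sepE // mulg1 (negbTE Ncs) (positive1 coxW).
right; exists s => //; split=> //.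
have [cs1|csN1] := eqVneq (c * s)%g 1%g.
  have cE : c = s by apply: (mulIg s); rewrite cs1 (mulSS oS).
  by apply: (mulgI w'^-1)%g; rewrite mulVg mulgA -/c cE (mulSS oS).
exfalso; have [t St lt_t] := len_descent gS oS csN1.
have st : s != t.
  by apply: contraTneq lt_t => <-; rewrite (mulKS oS) // -leqNgt ltnW.
have pst : positive s t.
  apply: contraT => /(len_neg coxW actD actZ act1 actM actS St) lt_st.
  have : len (s * t)%g = 0%N.
    by apply/eqP; rewrite -leqn0 -ltnS; apply: leq_trans lt_st (lenS gS Ss).
  move/(len_eq0 gS)/eqP; rewrite -eq_invg_mul (invS oS Ss) => /eqP h.
  by rewrite h eqxx in st.
have sept : separates y y' (w * s, t)%g.
  have Nct : ~~ positive (c * s)%g t by rewrite /positive -leqNgt ltnW.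
  by rewrite sepE // pst (negbTE Nct).
have J1 : (w * 1, s)%g \in roots by rewrite inE.
have J2 : (w * s, t)%g \in roots by rewrite inE.
have [k] := one _ _ J1 J2 seps sept; rewrite /root /= mulg1 actM => ek.
have {}ek : alpha s = k *: act s (alpha t).
  by rewrite -(actK act1 actM w (alpha s)) ek actZ (actK act1 actM).
have [x0 d0 _] := ex_dom.
have [_ ht] := dsg s d0 St; rewrite pst in ht.
have kp : 0 < k.
  have := d0 s Ss; rewrite {1}ek fC fZl fC => h.
  by rewrite -(pmulr_lgt0 _ ht).
have := d0 s Ss; have : act s (alpha s) = k *: alpha t.
  by rewrite ek actZ -actM (mulSS oS) // act1.
rewrite (actS _ Ss) (refl_ss R coxW) // => h.
have : iform x0 (- alpha s) = k * iform x0 (alpha t) by rewrite h fC fZl fC.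
rewrite fC -scaleN1r fZl mulN1r fC => h2 h3.
have : 0 < - iform x0 (alpha s) by rewrite h2 mulr_gt0 // d0.
by rewrite oppr_gt0 ltNge ltW.
Qed.

Lemma tw_conj_mulS w s : s \in S -> tw_conj (w * s)%g = (a s * tw_conj w * s)%g.
Proof. by move=> Ss; rewrite /tw_conj aM invMg (invS oS (aS Ss)) !mulgA. Qed.

Lemma parallel_fix w s : s \in S -> parallel (tw (root (w * 1, s)%g)) (root (w * 1, s)%g) ->
  (a s * tw_conj w * s)%g = tw_conj w.
Proof.
move=> Ss [k]; rewrite /root mulg1 /= /tw => h.
have : act (tw_conj w) (alpha s) = k *: alpha (a s).
  have := congr1 (act (a w)^-1%g) (congr1 (twist a) h).
  rewrite twistK twistZ (twistA coxW act1 actM actS autA aS) twist_alpha actZ.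
  by rewrite (actK act1 actM) -!actM ?mulgA.
move/(refl_conj coxW actD actZ act1 actM actS Ss (aS Ss)) => ->.
by rewrite (mulKS oS).
Qed.

Lemma step_label y y' w w' : label y w -> label y' w' ->
  step iform root tw twV roots y y' ->
  twisted_shift S a (tw_conj w) (tw_conj w').
Proof.
move=> ly ly' [ry ry' one good_step].
have [->|[s Ss [-> seps]]] := single_label ly ly' one; first by left.
set u := tw_conj w; rewrite tw_conj_mulS // -/u.
have Js : (w * 1, s)%g \in roots by rewrite inE.
have p1 : positive 1%g s by apply: (positive1 coxW).
case: (good_step _ Js seps) => [h|h|/(parallel_fix Ss) ->]; last by left.
- right; exists s => //; split=> //; move: h.
  rewrite /separates (label_self 1%g ly Ss) p1 (label_tw 1%g ly Ss) aut1 mulg1 -/u /= => h.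
  have := len_neg coxW actD actZ act1 actM actS (aS Ss) h.
  rewrite -[X in (X < _)%N](lenV gS oS) invMg invgK (invS oS (aS Ss)) (lenV gS oS) => lt_u.
  by apply: leq_trans (lenMS gS _ Ss) _.
right; exists s => //; split=> //; move: h.
rewrite /separates (label_self 1%g ly Ss) p1 (label_twV 1%g ly Ss) mulg1 -/u /= => h.
have lt_u := len_neg coxW actD actZ act1 actM actS Ss h.
by rewrite -mulgA; apply: leq_trans (lenSM gS oS _ (aS Ss)) _.
Qed.

(** A root violating the hypothesis of [len_add] is a wall crossed both between y and its image and
    between the two images. Inverses are taken because [label_tw] involves the inverse of
    [tw_conj w]. *)
Lemma geodesic_tw y y' w w' : label y w -> label y' w' ->
  geodesic iform root tw roots y y' ->
  len (tw_conj w * (w^-1 * w'))%g = (len (tw_conj w) + len (w^-1 * w')%g)%N.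
Proof.
move=> ly ly' ap; set u := tw_conj w; set c := (w^-1 * w')%g.
rewrite -(lenV gS oS) -(lenV gS oS u) -(lenV gS oS c) addnC invMg.
apply: (len_add coxW actD actZ act1 actM actS) => r s Ss pr nur pcur.
have gy' v t : t \in S ->
    side (tw y') (w * v, t)%g = positive (c^-1 * u^-1 * a v)%g (a t).
  move=> St; have -> : (w * v)%g = (w' * (c^-1 * v))%g by rewrite /c invMg invgK mulgA
    mulgA mulgV mul1g.
  rewrite (label_tw _ ly' St); congr positive.
  by rewrite /u /c /tw_conj !aM !autVg !aM !autVg !invMg !invgK !mulgA !mulgK.
have := ap (w * a' r, a' s)%g; rewrite inE /= aVS // => /(_ isT).
rewrite /separates (label_self _ ly (aVS Ss)) (label_tw _ ly (aVS Ss)) gy' ?aVS //.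
rewrite !permKV -/u -(positive_aut (a' r)) !permKV pr.
by rewrite (negbTE nur) pcur.
Qed.

Lemma geodesic_twV y y' w w' : label y w -> label y' w' ->
  geodesic iform root twV roots y y' ->
  len ((a (w^-1 * w'))^-1 * tw_conj w)%g = (len (w^-1 * w')%g + len (tw_conj w))%N.
Proof.
move=> ly ly' ap; set u := tw_conj w; set c := (w^-1 * w')%g.
rewrite -(lenV gS oS c) -(len_autE c^-1%g) autVg.
apply: (len_add coxW actD actZ act1 actM actS) => r s Ss pr nur pcur.
have giy' : side (twV y') (w * r, s)%g = positive ((a c)^-1 * u * r)%g s.
  have -> : (w * r)%g = (w' * (c^-1 * r))%g by rewrite /c invMg invgK mulgA mulgA mulgV
    mul1g.
  rewrite (label_twV _ ly' Ss); congr positive.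
  by rewrite /u /c /tw_conj !aM !autVg !invMg !invgK !mulgA !mulgK.
have := ap (w * r, s)%g; rewrite inE /= Ss => /(_ isT).
rewrite /separates (label_self _ ly Ss) (label_twV _ ly Ss) giy' -/u pr (negbTE nur).
by rewrite pcur.
Qed.

Lemma tw_conj_conj w w' : tw_conj w' = (a (w^-1 * w')^-1 * tw_conj w * ((w^-1 *
  w')^-1)^-1)%g.
Proof.
by rewrite /tw_conj !autVg aM !autVg !invMg !invgK !mulgA !mulgK.
Qed.

Lemma link_label y y' w w' : label y w -> label y' w' ->
  link iform root tw twV roots y y' ->
  twisted_strong S a (tw_conj w) (tw_conj w').
Proof.
move=> ly ly' [_ _ [st|[one fx]]]; last first.
  have [->|[s Ss [-> seps]]] := single_label ly ly' one; first by left.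
  left; rewrite tw_conj_mulS //; apply: (parallel_fix Ss).
  by apply: fx => //; rewrite inE.
have cV : (w'^-1 * w)%g = ((w^-1 * w')^-1)%g by rewrite invMg invgK.
right; set u := tw_conj w; set u' := tw_conj w'; set c := (w^-1 * w')%g.
have uc : u' = ((a c)^-1 * u * c)%g by rewrite /u' (tw_conj_conj w) -/c invgK autVg.
case: st => [[h1 h2]|[h1 h2]].
  have e1 := geodesic_tw ly ly' h1; have e2 := geodesic_twV ly' ly h2.
  rewrite cV -/c -/u' autVg invgK (lenV gS oS) in e2; rewrite -/c -/u in e1.
  have E : (a c * u')%g = (u * c)%g by rewrite uc !mulgA mulgV mul1g.
  split; first by apply/eqP; rewrite -(eqn_add2r (len c)) -e1 -E e2 addnC.
  exists c^-1%g; rewrite autVg invgK uc; split=> //; right.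
  by rewrite e1 (lenV gS oS) addnC.
have e1 := geodesic_twV ly ly' h1; have e2 := geodesic_tw ly' ly h2.
rewrite cV -/c -/u' (lenV gS oS) in e2; rewrite -/c -/u in e1.
have E : ((a c)^-1 * u)%g = (u' * c^-1)%g by rewrite uc mulgK.
split; first by apply/eqP; rewrite -(eqn_add2r (len c)) addnC -e1 E e2.
exists c^-1%g; rewrite autVg invgK uc; split=> //; left.
by rewrite e1 (lenV gS oS).
Qed.

Lemma reach_label y y' w : regular roots y -> label y w ->
  reach iform root tw twV roots y y' ->
  exists2 w', label y' w' & clos_refl_trans W (twisted_shift S a) (tw_conj w) (tw_conj w').
Proof.
move=> ry ly /clos_rt_rtn1_iff; elim=> [|u v st _ [w' lu cw]].
  by exists w => //; apply: rt_refl.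
have [_ rv _ _] := st; have [w'' lv] := ex_label rv; exists w'' => //.
by apply: rt_trans cw _; apply: rt_step; apply: step_label st.
Qed.

Lemma linked_label y y' w w' : label y w -> label y' w' -> regular roots y ->
  linked iform root tw twV roots y y' ->
    clos_refl_trans W (twisted_strong S a) (tw_conj w) (tw_conj w').
Proof.
move=> + ly' ry /clos_rt_rt1n_iff lyy';
  elim: lyy' w ly' ry => [x|x y1 z lk _ IH] w lz rx lx.
  have sx : link iform root tw twV roots x x.
    split=> //; left; left.
    by split=> i _; rewrite /separates eqxx andbF.
  by apply: rt_step; apply: link_label sx.
have [_ ry1 _] := lk; have [w1 ly1] := ex_label ry1.
apply: (rt_trans _ _ _ (tw_conj w1)); last exact: IH.
by apply: rt_step; apply: link_label lk.
Qed.

Theorem conj_confluence z : exists p q,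
  [/\ clos_refl_trans W (twisted_shift S a) w0 p,
      clos_refl_trans W (twisted_shift S a) (tw_conj z) q &
      clos_refl_trans W (twisted_strong S a) p q].
Proof.
have [x0 d0 _] := ex_dom.
have [r1 l1] := dominant_label 1%g d0; have [rz lz] := dominant_label z d0.
have [y [y' [ry ry' lk]]] := confluence (iformDl actD) (iformZl actZ) (iformC act)
  iform_pos rootN0 twZ twD twK twVK iform_tw
  (max_cone_rV (iformDl actD) (iformZl actZ) (iformC act) (iform_ge act1) twZ twD twK twVK)
  stable_roots r1 rz.
have [w lw cw] := reach_label r1 l1 ry; have [w' lw' cw'] := reach_label rz lz ry'.
exists (tw_conj w), (tw_conj w'); split=> //.
  by move: cw; rewrite /tw_conj aut1 invg1 mul1g mulg1.
by apply: linked_label lk => //; apply: reach_regular ry r1.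
Qed.

(** If u s or (a s) u is longer than u, then s itself is a conjugator with additive length. If both
    are shorter, [cyc_fix] shows that nothing has changed. *)
Lemma shift_strong u v : twisted_shift S a u v -> len u = len v -> twisted_strong S a u v.
Proof.
case=> [->|[s Ss [-> _]] el]; first by left.
have len_s t : t \in S -> len t = 1%N.
  move=> St; apply/eqP; rewrite eqn_leq (lenS gS St).
  by have := positive1 coxW St; rewrite /positive mul1g; apply: leq_trans.
have [p|np] := boolP (positive u s).
  right; split=> //; exists s; split; first by rewrite (invS oS Ss).
  right; rewrite (invS oS Ss) (len_s s Ss) add1n; apply/eqP.
  by rewrite eqn_leq (lenMS gS _ Ss).
have lasu : len (a s * u)%g = len (u^-1 * a s)%g.
  by rewrite -(lenV gS oS) invMg (invS oS (aS Ss)).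
have [p|np'] := boolP (positive u^-1 (a s)).
  right; split=> //; exists s; split; first by rewrite (invS oS Ss).
  left; rewrite (len_s s Ss) add1n; apply/eqP.
  by rewrite eqn_leq (lenSM gS oS _ (aS Ss)) lasu -(lenV gS oS u).
left; apply: (cyc_fix coxW actD actZ act1 actM actS Ss (aS Ss)) => //.
  exact: (len_neg coxW actD actZ act1 actM actS Ss np).
by rewrite lasu -(lenV gS oS u); apply: (len_neg coxW actD actZ act1 actM actS (aS Ss) np').
Qed.

Lemma twisted_strong_sym u v : twisted_strong S a u v -> twisted_strong S a v u.
Proof.
case=> [->|[el [x [vE h]]]]; first by left.
right; split=> //; exists x^-1%g; rewrite autVg invgK (lenV gS oS).
have vx : (v * x)%g = (a x * u)%g by rewrite vE mulgKV.
have xv : ((a x)^-1 * v)%g = (u * x^-1)%g by rewrite vE -mulgA mulKg.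
split; first by rewrite -mulgA vx mulKg.
by rewrite vx xv -el; case: h; [right | left].
Qed.

End Chambers.

Local Open Scope group_scope.

(** * Return to the twisted group *)

Section Twisted.
Variables (W : finGroupType) (S : {set W}) (delta : {perm W}).
Hypothesis coxW : coxeter_system S.
Hypothesis autD : delta \in Aut [set: W].
Hypothesis deltaS : {in S, forall s, delta s \in S}.
Local Notation tw := (twisted autD).
Local Notation len := (cox_length S).
Local Notation inW := (inW autD).

Variable a : {perm W}.
Hypothesis Da : a \in <[delta]>.

Lemma cycle_aut : a \in Aut [set: W].
Proof. by apply: fintype.subsetP Da; rewrite cycle_subG. Qed.

Lemma cycle_stable : {in S, forall s, a s \in S}.
Proof.
have /cycleP[k ->] := Da; move=> s Ss; elim: k => [|k IH]; first by rewrite expg0 perm1.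
by rewrite expgSr permM deltaS.
Qed.

Definition elt w : tw := inDelta autD a * inW w.

Lemma tw_length_elt w : tw_length S (elt w) = len w.
Proof. by have /cycleP[k ak] := Da; rewrite /elt ak tw_lengthE. Qed.

Lemma inWM x y : inW (x * y) = inW x * inW y.
Proof. exact: (@sdpair1_morphM _ _ _ _ (twist_act autD) x y (finset.in_setT x)
  (finset.in_setT y)). Qed.

Lemma inWV x : inW x^-1 = (inW x)^-1.
Proof.
have inW1 : inW 1 = 1 by apply: (mulgI (inW 1)); rewrite -inWM !mulg1.
by apply: (mulgI (inW x)); rewrite -inWM !mulgV inW1.
Qed.

Lemma elt_conj x w : inW x * elt w * (inW x)^-1 = elt (a x * w * x^-1).
Proof.
rewrite /elt !inWM inWV !mulgA; congr (_ * _ * _).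
have -> : inW (a x) = inW x ^ inDelta autD a.
  by rewrite -(@sdpair_act _ _ _ _ (twist_act autD)) ?inE.
by rewrite /conjg mulKVg.
Qed.

Lemma cyc_shift_elt u v : twisted_shift S a u v -> cyc_shift S (elt u) (elt v).
Proof.
case=> [->|[s Ss [-> le_vu]]]; first exact: connect0.
apply: connect1; rewrite /cyc_shift_step !tw_length_elt le_vu andbT.
apply/existsP; exists s; rewrite Ss /=.
have sV := invS (cox_ord coxW) Ss.
by rewrite -{2}sV -elt_conj -inWV sV.
Qed.

Lemma strong_conj_elt u v : twisted_strong S a u v -> strong_conj S (elt u) (elt v).
Proof.
case=> [->|[el [x [vE h]]]]; first exact: connect0.
subst v; apply: connect1; rewrite /elem_strong_conj !tw_length_elt el eqxx /=.
apply/existsP; exists x; rewrite elt_conj eqxx /=.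
have -> : inW x * elt u = elt (a x * u).
  by apply: (mulIg (inW x)^-1); rewrite elt_conj /elt !inWM inWV !mulgA.
have -> : elt u * (inW x)^-1 = elt (u * x^-1) by rewrite /elt inWM inWV mulgA.
by rewrite !tw_length_elt -?el; case: h => ->; rewrite eqxx ?orbT.
Qed.

End Twisted.

Theorem theorem3p2 (W : finGroupType) (S : {set W}) (delta : {perm W})
  (coxW : coxeter_system S) (autD : delta \in Aut [set: W])
  (deltaS : {in S, forall s, delta s \in S})
  (O : {set twisted autD}) (classO : is_conj_class O) :
  (forall w, w \in O ->
     exists2 w', w' \in min_length S O & cyc_shift S w w') /\
  (forall w w', w \in min_length S O -> w' \in min_length S O ->
     strong_conj S w w').
Proof.
have [act [actD actZ act1 actM actS]] := ex_rep (Rdefinitions.R : realType) coxW.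
have [u0 OE] := classO.
pose a := u0.1; have Da : a \in <[delta]> by rewrite /a; case: (u0) => ax h; have := h;
  rewrite inE => /andP[].
have autA := cycle_aut autD Da; have aS := cycle_stable deltaS Da.
pose F := elt autD a.
have O_conj x u : u \in O -> inW autD x * u * (inW autD x)^-1 \in O.
  rewrite OE => /imsetP[y _ ->]; apply/imsetP; exists (x * y) => //.
  by rewrite inWM invMg !mulgA.
have O_rel u v : u \in O -> v \in O -> exists p x, [/\ u = F p & v = F (a x * p * x^-1)].
  rewrite OE => /imsetP[x _ ->] /imsetP[y _ ->].
  have u0E : u0 = F u0.2 by rewrite /F /elt -sdpairE.
  exists (a x * u0.2 * x^-1), (y * x^-1); split.
    by rewrite {1}u0E (elt_conj autD Da).
  rewrite /F -!(elt_conj autD Da) -/F -u0E inWM inWV.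
  by rewrite invMg invgK !mulgA !mulgKV.
have O_cyc p q : F p \in O -> twisted_shift S a p q -> F q \in O.
  move=> Op [->//|[s Ss [-> _]]]; have sV := invS (cox_ord coxW) Ss.
  by rewrite -{2}sV /F -(elt_conj autD Da); apply: O_conj.
have O_cycs p q : clos_refl_trans W (twisted_shift S a) p q -> F p \in O ->
    F q \in O /\ cyc_shift S (F p) (F q).
  elim=> [x y xy Ox|x Ox|x y z _ IH1 _ IH2 /IH1[/IH2[Oz yz] xy]].
  - by split; [apply: O_cyc xy | apply: (cyc_shift_elt coxW)].
  - by split=> //; apply: connect0.
  by split=> //; apply: connect_trans xy yz.
have scs p q : clos_refl_trans W (twisted_strong S a) p q -> strong_conj S (F p) (F q).
  elim=> [x y xy|x|x y z _ IH1 _ IH2]; [exact: strong_conj_elt|exact: connect0|].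
  exact: connect_trans IH1 IH2.
have scs_len p q : clos_refl_trans W (twisted_strong S a) p q ->
  cox_length S p = cox_length S q.
  by elim=> [x y [->|[]]|//|x y z _ -> _ ->].
have conf u v : u \in O -> v \in O -> exists p q p' q', [/\ u = F p, v = F q,
    clos_refl_trans W (twisted_shift S a) p p', clos_refl_trans W (twisted_shift S a) q q' &
    clos_refl_trans W (twisted_strong S a) p' q'].
  move=> /O_rel h /h[p [x [-> ->]]].
  (* The chamber labelled x^-1 stands for the conjugate by x. *)
  have [p' [q' [h1 h2 h3]]] := conj_confluence coxW actD actZ act1 actM actS p autA aS x^-1.
  exists p, (a x * p * x^-1), p', q'; split=> //.
  by move: h2; rewrite /tw_conj (autVg autA) invgK.
have tw_F p : tw_length S (F p) = cox_length S p by apply: tw_length_elt.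
have cycs_len p q : clos_refl_trans W (twisted_shift S a) p q ->
  cox_length S q <= cox_length S p.
  elim=> [x y [->|[s _ []]]|//|x y z _ le1 _ le2] //; exact: leq_trans le2 le1.
(* From a minimal element a shift cannot change the length, so [shift_strong] applies. *)
have min_sc p q : clos_refl_trans W (twisted_shift S a) p q -> F p \in min_length S O ->
    F q \in min_length S O /\ clos_refl_trans W (twisted_strong S a) p q.
  elim=> [x y xy mx|x mx|x y z _ IH1 _ IH2 /IH1[/IH2[mz yz] xy]].
  - have := mx; rewrite !inE => /andP[Ox /forall_inP minx].
    have Oy := O_cyc _ _ Ox xy.
    have el : cox_length S x = cox_length S y.
      apply/eqP; rewrite eqn_leq -!tw_F minx //= !tw_F.
      by apply: cycs_len; apply: rt_step.
    split; first by rewrite Oy; apply/forall_inP => v /minx; rewrite !tw_F el.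
    by apply: rt_step; apply: (shift_strong coxW actD actZ act1 actM actS aS).
  - by split=> //; apply: rt_refl.
  by split=> //; apply: rt_trans xy yz.
have sc_sym p q : clos_refl_trans W (twisted_strong S a) p q ->
  clos_refl_trans W (twisted_strong S a) q p.
  elim=> [x y xy|x|x y z _ IH1 _ IH2]; [|exact: rt_refl|exact: rt_trans IH2 IH1].
  by apply: rt_step; apply: (twisted_strong_sym coxW autA).
split=> [w Ow|w w' mw mw'].
  case: (arg_minnP (fun u : twisted autD => tw_length S u) Ow) => m Om mmin.
  (* [p'] has the length of [q'], which is at most that of the minimal [m]. *)
  have [p [q [p' [q' [wE mE pp' qq' pq']]]]] := conf w m Ow Om.
  rewrite wE in Ow *; rewrite mE in Om mmin.
  have [Op' cp] := O_cycs _ _ pp' Ow.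
  exists (F p') => //; rewrite inE Op'; apply/forall_inP => v Ov.
  rewrite tw_F (scs_len _ _ pq'); apply: leq_trans (cycs_len _ _ qq') _.
  by rewrite -tw_F; apply: mmin.
have [Ow Ow'] : w \in O /\ w' \in O by move: mw mw';
  rewrite !inE => /andP[-> _] /andP[-> _].
have [p [q [p' [q' [wE wE' pp' qq' pq']]]]] := conf w w' Ow Ow'.
rewrite wE in mw *; rewrite wE' in mw' *; apply: scs.
have [_ s1] := min_sc _ _ pp' mw; have [_ s2] := min_sc _ _ qq' mw'.
by apply: rt_trans s1 (rt_trans _ _ _ _ _ pq' (sc_sym _ _ s2)).
Qed.
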